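(* The maps $I$ and $\delta_V$ satisfy $$I^2=I\ \text{ on }\Omega_{0,p}\ (p\ge1),\qquad I\,d_H=0\ \text{ on }\Omega_{1,p}\ (p\ge1),\qquad \delta_V^2=0,$$ and the following identities hold: $$\gamma=(I+d_H\mathfrak h_H)\gamma,\quad \gamma\in\Omega_{0,p},\ p\ge1,$$ $$\gamma=(\delta_Vh_V+\mathfrak h_V\delta_V)\gamma,\quad\gamma\in\mathcal I_1,$$ $$\gamma=(\delta_V\mathfrak h_V+\mathfrak h_V\delta_V)\gamma,\quad\gamma\in\mathcal I_p,\ p>1.$$ In particular, the horizontal and vertical sequences of the augmented aromatic bicomplex are exact, i.e. the rows $\cdots\xrightarrow{d_H}\Omega_{2,p}\xrightarrow{d_H}\Omega_{1,p}\xrightarrow{d_H}\Omega_{0,p}\xrightarrow{I}\mathcal I_p\to0$ ($p\ge1$) and $\cdots\xrightarrow{d_H}\Omega_{2,0}\xrightarrow{d_H}\Omega_{1,0}\xrightarrow{d_H}\Omega_{0,0}$ (exact at $\Omega_{n,0}$ for $n\ge1$), the columns $0\to\Omega_{n,0}\xrightarrow{d_V}\Omega_{n,1}\xrightarrow{d_V}\cdots$ ($n\ge0$), and the column $\mathcal I_1\xrightarrow{\delta_V}\mathcal I_2\xrightarrow{\delta_V}\cdots$ (exact at $\mathcal I_p$ for $p\ge2$) are exact; and the Euler–Lagrange complex $$\cdots\xrightarrow{d_H}\Omega_{2,0}\xrightarrow{d_H}\Omega_{1,0}\xrightarrow{d_H}\Omega_{0,0}\xrightarrow{\delta_V}\mathcal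 I_1\xrightarrow{\delta_V}\mathcal I_2\xrightarrow{\delta_V}\cdots$$ is exact.
   Context: Aromatic forests. Let $V$ be a finite nonempty set of nodes and $E\subset V\times V$ a set of edges; an edge $(v,w)$ goes from $v$ to $w$ and then $v$ is a predecessor of $w$; $\Pi(v)$ is the set of predecessors of $v$. Each node is the source of at most one edge; nodes with no outgoing edge are called roots. $V$ is split into vertices $V^\bullet$ and covertices $V^\circ$. The covertices are numbered $1,\dots,p$ (denote them $c_1,\dots,c_p$), the roots are numbered $1,\dots,n$, the vertices are not numbered. Such graphs, up to isomorphism preserving the vertex/covertex type and the numberings, are called aromatic forests; $\mathcal F_{n,p}$ is the set of aromatic forests with $n$ roots and $p$ covertices. The order $|\gamma|$ is the number of nodes. Aromatic forms. $S_n^\bullet$ and $S_p^\circ$ act on $\mathcal F_{n,p}$ by permuting the numbers of the roots, respectively covertices. $\wedge^\bullet\gamma=\frac1{n!}\sum_{\sigma\in S_n^\bullet}\varepsilon(\sigma)\sigma\gamma$, $\wedge^\circ\gamma=\frac1{p!}\sum_{\sigma\in S_p^\circ}\varepsilon(\sigma)\sigma\gamma$, $\wedge=\wedge^\bullet\wedge^\circ$, extended linearly. $\Omega_{n,p}=\wedge\operatorname{Span}_{\mathbb R}(\mathcal F_{n,p})$. Derivatives. For a root $r$ and a node $u$ (possibly $u=r$), $D^{r\to u}\gamma$ is $\gamma$ with the edge $(r,u)$ added, $D^r\gamma=\sum_{u\in V}D^{r\to u}\gamma$. For $\gamma\in\mathcal F_{n,p}$ with last root $r_n$ ($n\ge1$),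 $d_H\gamma=D^{r_n}\gamma$, and $d_V\gamma=\wedge\sum_{v\in V^\bullet}\gamma_{v\to c_{p+1}}$, where $\gamma_{v\to c_{p+1}}$ replaces the vertex $v$ by a covertex numbered $p+1$. By linearity $d_H:\Omega_{n,p}\to\Omega_{n-1,p}$, $d_V:\Omega_{n,p}\to\Omega_{n,p+1}$. The vertical homotopy operator is $h_V:\Omega_{n,p}\to\Omega_{n,p-1}$ ($p\ge1$), $h_V\gamma=\frac p{|\gamma|}\gamma_{c_p\to\bullet}$ for forests $\gamma$ (covertex $c_p$ replaced by an unnumbered vertex), extended linearly. Detaching and Euler operators. For a node $v$ of $\gamma$, $\gamma_{v^\diamond}$ is obtained by removing all edges pointing to $v$ (including a possible edge $(v,v)$) and marking $v$ with $\diamond$; the nodes of $\Pi(v)$ (taken in $\gamma$) become ''detached'' nodes, i.e. additional roots without numbers. $(\cdot)^\diamond$ removes the mark. On a graph with set $R_0$ of detached nodes, for $J\subset R_0$, $D^J$ is the sum over all maps $\varphi:J\to V$ (with values different from the marked node as long as a mark is present) of the graphs obtained by adding the edges $(w,\varphi(w))$, $w\in J$; the nodes of $J$ are then no longer detached. $D^q=\sum_{J\subset R_0,|J|=q}D^J$. The Euler operator of order $q\ge0$ at $v$ is $\mathcal E_v^q\gamma=(-1)^{|\Pi(v)|-q}(D^{|\Pi(v)|-q}\gamma_{v^\diamond})^\diamond$ ($0$ if $q>|\Pi(v)|$), whose terms have exactly $q$ detached nodes. If after all operations exactly one detached node remains, it becomes the root numbered $n+1$ of the resulting forest. All operators are extended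 linearly. Augmented bicomplex. For $p\ge1$: $I:\Omega_{0,p}\to\Omega_{0,p}$, $I\gamma=\wedge\mathcal E^0_{c_p}\gamma$; $\mathcal I_p=I(\Omega_{0,p})$; $\delta_V=I\circ d_V$ (defined on $\Omega_{0,0}$ with values in $\mathcal I_1$, and on $\mathcal I_p$ with values in $\mathcal I_{p+1}$). Augmented homotopy operators: $\mathfrak h_H\gamma=\wedge\sum_{q\ge1}\frac1qD^{q-1}\mathcal E^q_{c_p}\gamma$ for $\gamma\in\Omega_{0,p}$, and $\mathfrak h_V=I\circ h_V$. *)

(* Defs.v *)
From HB Require Import structures.
From mathcomp Require Import all_boot all_order all_fingroup all_algebra.
From mathcomp Require Import generic_quotient finmap.
From mathcomp Require Import boolp classical_sets reals.
From mathcomp Require Import monalg.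

Set Implicit Arguments.
Unset Strict Implicit.
Unset Printing Implicit Defensive.

Import GRing.Theory.

Local Open Scope quotient_scope.
Local Open Scope classical_set_scope.
Local Open Scope ring_scope.

(* Raw graphs on the node set V with n numbered roots and p covertices.  As a
   node is the source of at most one edge, the edge set is encoded by the
   partial map [succ] (edge v -> w iff [succ v = Some w]).  Numbers 1..n are
   encoded as 'I_n, the last number being [ord_max].  [mark] is the node
   carrying the diamond, if any.  Aromatic forests are singled out by
   [is_forest] below; the more general graphs, with a mark and with detached
   nodes, only occur inside the Euler operators. *)
Record graph (V : finType) (n p : nat) := Graph {
  succ : {ffun V -> option V};
  root : {ffun 'I_n -> V};
  cov  : {ffun 'I_p -> V};
  mark : option V }.

Definition graph_tuple (V : finType) n p (g : graph V n p) :=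
  (succ g, root g, cov g, mark g).
Definition tuple_graph (V : finType) n p
    (x : {ffun V -> option V} * {ffun 'I_n -> V} * {ffun 'I_p -> V} * option V) :=
  let: (s, r, c, d) := x in Graph s r c d.
Lemma graph_tupleK (V : finType) n p :
  cancel (@graph_tuple V n p) (@tuple_graph V n p).
Proof. by case. Qed.
HB.instance Definition _ (V : finType) n p :=
  Choice.copy (graph V n p) (can_type (@graph_tupleK V n p)).

Definition is_vertex (V : finType) n p (g : graph V n p) : pred V :=
  [pred v | v \notin codom (cov g)].

Definition predecessors (V : finType) n p (g : graph V n p) (v : V) : pred V :=
  [pred w | succ g w == Some v].

Definition detached (V : finType) n p (g : graph V n p) : pred V :=
  [pred v | (succ g v == None) && (v \notin codom (root g))].

Definition is_forest (V : finType) n p (g : graph V n p) : bool :=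
  [&& injectiveb (root g), injectiveb (cov g),
      [forall v, (succ g v == None) == (v \in codom (root g))]
    & mark g == None].

Definition iso (V W : finType) n p (g : graph V n p) (h : graph W n p) : Prop :=
  exists f : V -> W,
    [/\ bijective f,
        forall v, succ h (f v) = omap f (succ g v),
        forall i, root h i = f (root g i),
        forall i, cov h i = f (cov g i)
      & mark h = omap f (mark g)].

Lemma iso_refl (V : finType) n p (g : graph V n p) : iso g g.
Proof.
exists id; split=> // [|v|]; first by exists id.
  by case: (succ g v).
by case: (mark g).
Qed.

Lemma iso_sym (V W : finType) n p (g : graph V n p) (h : graph W n p) :
  iso g h -> iso h g.
Proof.
case=> f [[f' fK f'K] hs hr hc hm]; exists f'; split.
- by exists f.
- by move=> w; rewrite -{2}(f'K w) hs; case: (succ g _) => //= v; rewrite fK.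
- by move=> i; rewrite hr fK.
- by move=> i; rewrite hc fK.
- by rewrite hm; case: (mark g) => //= v; rewrite fK.
Qed.

Lemma iso_trans (U V W : finType) n p (g : graph U n p) (h : graph V n p)
    (k : graph W n p) : iso g h -> iso h k -> iso g k.
Proof.
case=> f [bf hs hr hc hm] [f' [bf' hs' hr' hc' hm']]; exists (f' \o f); split.
- exact: bij_comp.
- by move=> v /=; rewrite hs' hs; case: (succ g v).
- by move=> i; rewrite hr' hr.
- by move=> i; rewrite hc' hc.
- by rewrite hm' hm; case: (mark g).
Qed.

(* Every nonempty finite graph is isomorphic to one whose node set is 'I_m.+1. *)
Definition cgraph (n p : nat) := {m : nat & graph 'I_m.+1 n p}.

Definition cgraph_iso n p : rel (cgraph n p) :=
  fun g h => `[< iso (tagged g) (tagged h) >].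

Lemma cgraph_iso_refl n p : reflexive (@cgraph_iso n p).
Proof. by move=> g; apply/asboolP; apply: iso_refl. Qed.

Lemma cgraph_iso_sym n p : symmetric (@cgraph_iso n p).
Proof. by move=> g h; apply/asboolP/asboolP; apply: iso_sym. Qed.

Lemma cgraph_iso_trans n p : transitive (@cgraph_iso n p).
Proof.
move=> h g k /asboolP gh /asboolP hk; apply/asboolP; exact: iso_trans gh hk.
Qed.

Canonical cgraph_iso_equiv n p :=
  EquivRel (@cgraph_iso n p) (@cgraph_iso_refl n p) (@cgraph_iso_sym n p)
           (@cgraph_iso_trans n p).

Definition agraph (n p : nat) := {eq_quot (@cgraph_iso n p)}.
HB.instance Definition _ n p := Choice.on (agraph n p).
HB.instance Definition _ n p := EqQuotient.on (agraph n p).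

Definition cls m n p (g : graph 'I_m.+1 n p) : agraph n p :=
  \pi_(agraph n p) (Tagged (fun m => graph 'I_m.+1 n p) g).

Definition forests (n p : nat) : set (agraph n p) :=
  [set c | is_forest (tagged (repr c))].
Arguments forests : clear implicits.

Notation lincomb R n p := {malg R[agraph n p]}.

Definition basis_elt (R : realType) m n p (g : graph 'I_m.+1 n p) :
    lincomb R n p := << cls g >>.

(* Linear extension.  [f] is evaluated on a chosen representative of each
   isomorphism class; every [f] used below is invariant under isomorphism. *)
Definition linext (R : realType) n p n' p'
    (f : forall m, graph 'I_m.+1 n p -> lincomb R n' p') (x : lincomb R n p) :
    lincomb R n' p' :=
  \sum_(c <- msupp x) x@_c *: f _ (tagged (repr c)).

Definition span_forests (R : realType) n p : set (lincomb R n p) :=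
  [set x | forall c, c \in msupp x -> forests n p c].
Arguments span_forests : clear implicits.

Definition perm_roots (V : finType) n p (s : 'S_n) (g : graph V n p) :
    graph V n p :=
  Graph (succ g) [ffun i => root g ((s^-1)%g i)] (cov g) (mark g).

Definition perm_covs (V : finType) n p (s : 'S_p) (g : graph V n p) :
    graph V n p :=
  Graph (succ g) (root g) [ffun i => cov g ((s^-1)%g i)] (mark g).

Definition wedge_root (R : realType) n p : lincomb R n p -> lincomb R n p :=
  linext (fun m g =>
    n`!%:R^-1 *: \sum_(s : 'S_n) (-1) ^+ s *: basis_elt R (perm_roots s g)).

Definition wedge_cov (R : realType) n p : lincomb R n p -> lincomb R n p :=
  linext (fun m g =>
    p`!%:R^-1 *: \sum_(s : 'S_p) (-1) ^+ s *: basis_elt R (perm_covs s g)).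

Definition wedge (R : realType) n p (x : lincomb R n p) : lincomb R n p :=
  wedge_root (wedge_cov x).

Definition Omega (R : realType) n p : set (lincomb R n p) :=
  [set wedge x | x in span_forests R n p].
Arguments Omega : clear implicits.

Definition extend_last (V : finType) n (f : {ffun 'I_n -> V}) (v : V) :
    {ffun 'I_n.+1 -> V} :=
  [ffun i => if unlift ord_max i is Some j then f j else v].

Definition drop_last (V : finType) n (f : {ffun 'I_n.+1 -> V}) :
    {ffun 'I_n -> V} :=
  [ffun i => f (lift ord_max i)].

(* D^{r -> u} for r the last root *)
Definition attach_last_root (V : finType) n p (u : V) (g : graph V n.+1 p) :
    graph V n p :=
  Graph [ffun w => if w == root g ord_max then Some u else succ g w]
        (drop_last (root g)) (cov g) (mark g).

Definition dH (R : realType) n p : lincomb R n.+1 p -> lincomb R n p :=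
  linext (fun m g => \sum_(u : 'I_m.+1) basis_elt R (attach_last_root u g)).

Definition vertex_to_cov (V : finType) n p (v : V) (g : graph V n p) :
    graph V n p.+1 :=
  Graph (succ g) (root g) (extend_last (cov g) v) (mark g).

Definition dV (R : realType) n p (x : lincomb R n p) : lincomb R n p.+1 :=
  wedge (linext (fun m g =>
    \sum_(v : 'I_m.+1 | is_vertex g v) basis_elt R (vertex_to_cov v g)) x).

Definition last_cov_to_vertex (V : finType) n p (g : graph V n p.+1) :
    graph V n p :=
  Graph (succ g) (root g) (drop_last (cov g)) (mark g).

Definition hV (R : realType) n p : lincomb R n p.+1 -> lincomb R n p :=
  linext (fun m g =>
    (p.+1%:R / #|'I_m.+1|%:R) *: basis_elt R (last_cov_to_vertex g)).

Definition detach (V : finType) n p (v : V) (g : graph V n p) : graph V n p :=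
  Graph [ffun w => if w \in predecessors g v then None else succ g w]
        (root g) (cov g) (Some v).

Definition unmark (V : finType) n p (g : graph V n p) : graph V n p :=
  Graph (succ g) (root g) (cov g) None.

(* [phi] is a partial map V -> V; the edges (w, phi w) are added. *)
Definition add_edges (V : finType) n p (phi : {ffun V -> option V})
    (g : graph V n p) : graph V n p :=
  Graph [ffun w => if phi w is Some u then Some u else succ g w]
        (root g) (cov g) (mark g).

Definition not_marked (V : finType) n p (g : graph V n p) : pred (option V) :=
  [pred y | (y != None) && (y != mark g)].

(* [phi \in pffun_on None J Q]: phi is None off J, and takes values in Q on J. *)
Definition DJ (R : realType) m n p (J : {set 'I_m.+1}) (g : graph 'I_m.+1 n p) :
    lincomb R n p :=
  \sum_(phi : {ffun 'I_m.+1 -> option 'I_m.+1}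
          | phi \in pffun_on None J (not_marked g))
     basis_elt R (add_edges phi g).

Definition Dq (R : realType) n p (q : nat) : lincomb R n p -> lincomb R n p :=
  linext (fun m g =>
    \sum_(J : {set 'I_m.+1} | (J \subset detached g) && (#|J| == q)) DJ R J g).

Definition unmark_lin (R : realType) n p : lincomb R n p -> lincomb R n p :=
  linext (fun m g => basis_elt R (unmark g)).

Definition euler (R : realType) m n p (q : nat) (v : 'I_m.+1)
    (g : graph 'I_m.+1 n p) : lincomb R n p :=
  let k := #|predecessors g v| in
  if (q <= k)%N then
    (-1) ^+ (k - q) *: unmark_lin (Dq (k - q) (basis_elt R (detach v g)))
  else 0.

Definition number_root (V : finType) n p (w : V) (g : graph V n p) :
    graph V n.+1 p :=
  Graph (succ g) (extend_last (root g) w) (cov g) (mark g).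

(* The only detached node w becomes the last root; graphs that do not have
   exactly one detached node are sent to 0. *)
Definition number_detached (R : realType) n p :
    lincomb R n p -> lincomb R n.+1 p :=
  linext (fun m g =>
    if #|detached g| == 1%N
    then \sum_(w : 'I_m.+1 | detached g w) basis_elt R (number_root w g)
    else 0).

Definition Iop (R : realType) p (x : lincomb R 0 p.+1) : lincomb R 0 p.+1 :=
  wedge (linext (fun m g => euler R 0 (cov g ord_max) g) x).

(* [calI R p] is the space $\mathcal I_{p+1}$, the image of $\Omega_{0,p+1}$. *)
Definition calI (R : realType) p : set (lincomb R 0 p.+1) :=
  @Iop R p @` Omega R 0 p.+1.
Arguments calI : clear implicits.

Definition deltaV (R : realType) p (x : lincomb R 0 p) : lincomb R 0 p.+1 :=
  Iop (dV x).

(* The sum over q >= 1 stops at the number of predecessors of the last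
   covertex, beyond which the Euler operators vanish. *)
Definition aug_hH (R : realType) p (x : lincomb R 0 p.+1) : lincomb R 1 p.+1 :=
  wedge (linext (fun m g =>
    let c := cov g ord_max in
    \sum_(1 <= q < #|predecessors g c|.+1)
      q%:R^-1 *: number_detached (Dq q.-1 (euler R q c g))) x).

Definition aug_hV (R : realType) p (x : lincomb R 0 p.+2) : lincomb R 0 p.+1 :=
  Iop (hV x).

Definition exact_at (U V W : zmodType) (A : set U) (f : U -> V) (B : set V)
    (g : V -> W) : Prop :=
  B `&` g @^-1` [set 0] = f @` A.

(* Main.v *)
From HB Require Import structures.
From mathcomp Require Import all_boot all_order all_fingroup all_algebra.
From mathcomp Require Import generic_quotient finmap.
From mathcomp Require Import boolp classical_sets reals.
From mathcomp Require Import monalg.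
Require Import Defs.

Set Implicit Arguments.
Unset Strict Implicit.
Unset Printing Implicit Defensive.

Import GRing.Theory Num.Theory.

Local Open Scope quotient_scope.
Local Open Scope classical_set_scope.
Local Open Scope ring_scope.

(** Operators are linear and do not see the names of the nodes, so identities
    between them are checked on labelled graphs ([lincomb_ind], [span_ind]); and
    [Omega] is the space of combinations of forests that are alternating both in
    the roots and in the covertices ([OmegaP]).

    Columns.  Turning a vertex into a covertex and a covertex back into a vertex
    returns either the graph itself or a graph in which a covertex has moved; the
    first kind occurs as often as there are vertices in [hV \o dV] and as there
    are covertices in [dV \o hV], and the second kind cancels by alternation
    ([vertical_homotopy]).  In total the graph itself occurs once per node, hence
    the division by the order in [hV].

    Rows with roots.  Let c be the last covertex and let [cut] be the sum, over
    the predecessors w of c, of the graphs where the edge from w to c is removed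
    and w becomes the last root.  Attaching the last root and then cutting either
    undoes the new edge or commutes with it, which is the relation [cut_attach].
    Once alternated, it says that on the kernel of [dH] the map [dH \o alt \o cut]
    is, up to a factor, N + n with N = [attach \o cut] and n the positive number
    of roots.  Now N moves the target of one edge ending at c; it is triangular
    for the number of predecessors of c, which is also its diagonal entry, so
    N + n is invertible and every element of the kernel is a boundary
    ([attach_exact_roots]).  The construction singles out c, but alternating the
    covertices afterwards commutes with [dH].  Without covertices, one goes
    through the column: [hV] is then a left inverse of [dV], and both commute with
    [dH] ([dH_exact_zero]).

    Rows without roots.  A forest is a tensor: each node carries its outgoing
    edge, and graphs can be expanded multilinearly in these edges ([multi]).  The
    edge from w to c is the sum of all edges leaving w minus those that avoid c.
    Expanding this for every predecessor of c writes a forest as a sum over sets J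
    of predecessors ([sum_reattached]), J being the nodes sent away from c.  When
    J contains all the predecessors the term is the Euler operator of order 0.
    Otherwise q predecessors remain to be attached to arbitrary nodes; [aug_hH]
    attaches all but one and [dH] the last one, so each term is obtained q times,
    and this is the reason for the factor 1/q ([euler0_homotopy]).  The Euler
    operator of order 0 replaces an edge to c by minus the sum of the others, so it
    kills the sum of all edges leaving a node, and hence [dH] ([euler0_attach]).

    The rest is formal.  As [Iop] is the identity up to [dH], and as [dV] and [hV]
    commute with [dH], an [Iop] that stands inside [Iop \o dV] or [Iop \o hV] can
    be erased ([Iop_dV_Iop], [Iop_hV_Iop]).  Applying [Iop] to the vertical
    homotopy then gives the augmented one. *)

(** * Graphs up to relabelling *)

Definition relabel (V : finType) n p (s : {perm V}) (g : graph V n p) :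
    graph V n p :=
  Graph [ffun v => omap s (succ g ((s^-1)%g v))] [ffun i => s (root g i)]
        [ffun i => s (cov g i)] (omap s (mark g)).

Lemma graphP (V : finType) n p (g h : graph V n p) :
  succ g =1 succ h -> root g =1 root h -> cov g =1 cov h ->
  mark g = mark h -> g = h.
Proof.
case: g h => [s r c d] [s' r' c' d'] /= /ffunP -> /ffunP -> /ffunP -> -> //.
Qed.

Lemma iso_relabel m m' n p (g : graph 'I_m.+1 n p) (h : graph 'I_m'.+1 n p) :
  iso g h -> exists (e : m' = m) (s : 'S_m.+1),
    eq_rect m' (fun k => graph 'I_k.+1 n p) h m e = relabel s g.
Proof.
case=> f [bf hs hr hc hm].
have e : m' = m by apply/eqP; have := bij_eq_card bf; rewrite !card_ord => -[->].
subst m'; exists erefl, (perm (bij_inj bf)) => /=.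
apply: graphP => [v|i|i|] /=.
- rewrite ffunE -{1}(permKV (perm (bij_inj bf)) v) permE hs.
  by case: (succ g _) => //= w; rewrite permE.
- by rewrite ffunE permE.
- by rewrite ffunE permE.
- by rewrite hm; case: (mark g) => //= w; rewrite permE.
Qed.

Lemma cls_relabel m n p (s : 'S_m.+1) (g : graph 'I_m.+1 n p) :
  cls (relabel s g) = cls g.
Proof.
apply/eqP; rewrite /cls eqmodE /= /cgraph_iso; apply/asboolP/iso_sym => /=.
exists s; split=> [|v|i|i|] //=; rewrite ?ffunE ?permK //.
exact: Bijective (permK s) (permKV s).
Qed.

(** Isomorphic graphs on the types ['I_m.+1] have the same m, so an invariant of
    isomorphism classes is a function that ignores permutations of the nodes. *)
Definition invariant (T : Type) n p (f : forall m, graph 'I_m.+1 n p -> T) :=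
  forall m (s : 'S_m.+1) g, f m (relabel s g) = f m g.

Lemma invariant_repr (T : Type) n p (f : forall m, graph 'I_m.+1 n p -> T)
    m (g : graph 'I_m.+1 n p) :
  invariant f -> f _ (tagged (repr (cls g))) = f _ g.
Proof.
move=> fI.
have: repr (cls g) = Tagged (fun m => graph 'I_m.+1 n p) g %[mod agraph n p].
  by rewrite reprK.
case: (repr _) => m' h /= /eqP; rewrite eqmodE => /asboolP /= /iso_sym.
by case/iso_relabel => e [s]; subst m' => /= ->.
Qed.

Section Linext.
Variable R : realType.
Implicit Types n p : nat.

Lemma basis_relabel m n p (s : 'S_m.+1) (g : graph 'I_m.+1 n p) :
  basis_elt R (relabel s g) = basis_elt R g.
Proof. by rewrite /basis_elt cls_relabel. Qed.

Lemma linext_is_linear n p n' p'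
    (f : forall m, graph 'I_m.+1 n p -> lincomb R n' p') : linear (linext f).
Proof.
move=> a x y; rewrite /linext.
pose d := (msupp x `|` msupp y)%fset.
have ext z : (msupp z `<=` d)%fset ->
    \sum_(c <- msupp z) z@_c *: f _ (tagged (repr c)) =
    \sum_(c <- d) z@_c *: f _ (tagged (repr c)).
  move=> zd; apply/big_fset_incl => // c _ /mcoeff_outdom ->; exact: scale0r.
rewrite !ext ?fsubsetUl ?fsubsetUr //; last first.
  apply: fsubset_trans (msuppD_le _ _) _.
  by apply: fsetSU; exact: msuppZ_le.
rewrite scaler_sumr -big_split /=; apply: eq_bigr => c _.
by rewrite mcoeffD mcoeffZ scalerDl scalerA.
Qed.

HB.instance Definition _ n p n' p' f :=
  GRing.isLinear.Build R (lincomb R n p) (lincomb R n' p') _ (@linext R n p n' p' f)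
    (linext_is_linear f).

Lemma linext_basis n p n' p' (f : forall m, graph 'I_m.+1 n p -> lincomb R n' p')
    m (g : graph 'I_m.+1 n p) :
  invariant f -> linext f (basis_elt R g) = f _ g.
Proof.
move=> fI; rewrite /linext /basis_elt msuppU oner_eq0 big_seq_fset1 mcoeffUU scale1r.
exact: invariant_repr.
Qed.

End Linext.

(** * Alternation over symmetric groups *)

Definition lift_last n (s : 'S_n) : 'S_n.+1 := lift_perm ord_max ord_max s.

Lemma lift_lastP n (t : 'S_n.+1) :
  t ord_max = ord_max -> exists s, t = lift_last s.
Proof.
move=> tmax.
have tl k : {j | t (lift ord_max k) = lift ord_max j}.
  have : ord_max != t (lift ord_max k).
    by rewrite -{1}tmax (inj_eq perm_inj) neq_lift.
  by case/unlift_some => j -> _; exists j.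
have f_inj : injective (fun k => sval (tl k)).
  move=> k k' /= e; apply: (@lift_inj _ ord_max); apply: (@perm_inj _ t).
  by apply: etrans (svalP (tl k)) _; rewrite e -(svalP (tl k')).
exists (perm f_inj); apply/permP => i; rewrite /lift_last.
case: (unliftP ord_max i) => [j ->|->]; last by rewrite lift_perm_id tmax.
by rewrite lift_perm_lift permE -(svalP (tl j)).
Qed.

Lemma odd_lift_last n (s : 'S_n) : lift_last s = s :> bool.
Proof. by rewrite odd_lift_perm addbb. Qed.

Notation swap_last n := (tperm (lift ord_max ord_max) ord_max : 'S_n.+2).

Lemma swap_last_lift (n : nat) (i : 'I_n) :
  swap_last n (lift ord_max (lift ord_max i)) = lift ord_max (lift ord_max i).
Proof.
by rewrite tpermD // ?neq_lift // (inj_eq (@lift_inj _ _)) neq_lift.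
Qed.

Lemma eq_ord_last_two n (T : Type) (h h' : 'I_n.+2 -> T) :
  h ord_max = h' ord_max ->
  h (lift ord_max ord_max) = h' (lift ord_max ord_max) ->
  (forall i, h (lift ord_max (lift ord_max i)) =
             h' (lift ord_max (lift ord_max i))) -> h =1 h'.
Proof.
move=> e1 e2 e3 i; case: (unliftP ord_max i) => [j|] -> //.
by case: (unliftP ord_max j) => [k|] ->.
Qed.

HB.lock Definition alternate (K : numFieldType) (M : lmodType K) n
    (act : 'S_n -> {linear M -> M}) (x : M) : M :=
  n`!%:R^-1 *: \sum_(s : 'S_n) (-1) ^+ s *: act s x.

Definition is_action (K : numFieldType) (M : lmodType K) n
    (act : 'S_n -> {linear M -> M}) :=
  (forall x, act 1%g x = x) /\
  (forall s t x, act s (act t x) = act (t * s)%g x).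

Definition alternating (K : numFieldType) (M : lmodType K) n
    (act : 'S_n -> {linear M -> M}) (x : M) :=
  forall s, act s x = (-1) ^+ s *: x.

Section Alternation.
Variables (K : numFieldType) (M : lmodType K) (n : nat).
Variable act : 'S_n -> {linear M -> M}.

Lemma alternate_is_linear : linear (alternate act).
Proof.
move=> a x y; rewrite alternate.unlock [RHS]addrC scalerA mulrC -scalerA -scalerDr.
congr (_ *: _); rewrite scaler_sumr -big_split /=; apply: eq_bigr => s _.
by rewrite linearP scalerDr !scalerA addrC mulrC.
Qed.
HB.instance Definition _ :=
  GRing.isLinear.Build K M M _ (alternate act) alternate_is_linear.

Lemma alternate_id x : alternating act x -> alternate act x = x.
Proof.
move=> xA; rewrite alternate.unlock.
rewrite (eq_bigr (fun=> x)) => [|s _]; last first.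
  by rewrite xA scalerA -expr2 sqrr_sign scale1r.
rewrite sumr_const card_Sn -scaler_nat scalerA.
by rewrite mulVf ?scale1r // pnatr_eq0 -lt0n fact_gt0.
Qed.

Hypothesis actP : is_action act.

Lemma alternating_alternate x : alternating act (alternate act x).
Proof.
move=> s; rewrite alternate.unlock linearZ /= scalerA mulrC -scalerA; congr (_ *: _).
rewrite linear_sum scaler_sumr (reindex_inj (mulIg s^-1)%g) /=.
apply: eq_bigr => t _; rewrite linearZ /= actP.2 mulgVK scalerA.
by rewrite odd_permM odd_permV signr_addb mulrC.
Qed.

Lemma alternate_act s x : alternate act (act s x) = (-1) ^+ s *: alternate act x.
Proof.
rewrite alternate.unlock scalerA mulrC -scalerA; congr (_ *: _).
rewrite scaler_sumr (reindex_inj (mulgI s^-1)%g) /=.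
apply: eq_bigr => t _; rewrite actP.2 mulKVg scalerA.
by rewrite odd_permM odd_permV signr_addb.
Qed.

End Alternation.

Lemma alternate_equivariant (K : numFieldType) (M N : lmodType K) n
    (actM : 'S_n -> {linear M -> M}) (actN : 'S_n -> {linear N -> N})
    (F : {linear M -> N}) x :
  (forall s x, F (actM s x) = actN s (F x)) ->
  F (alternate actM x) = alternate actN (F x).
Proof.
move=> FE; rewrite alternate.unlock linearZ linear_sum; congr (_ *: _).
by apply: eq_bigr => s _; rewrite linearZ /= FE.
Qed.

Lemma alternate_absorb (K : numFieldType) (M N : lmodType K) n
    (actM : 'S_n -> {linear M -> M}) (actN : 'S_n.+1 -> {linear N -> N})
    (F : {linear M -> N}) x :
  is_action actN ->
  (forall s x, F (actM s x) = actN (lift_last s) (F x)) ->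
  alternate actN (F (alternate actM x)) = alternate actN (F x).
Proof.
move=> aN FE; rewrite {2}alternate.unlock !linearZ !linear_sum /=.
rewrite (eq_bigr (fun=> alternate actN (F x))) => [|s _].
  rewrite sumr_const card_Sn -scaler_nat scalerA.
  by rewrite mulVf ?scale1r // pnatr_eq0 -lt0n fact_gt0.
rewrite !linearZ /= FE alternate_act // odd_lift_last.
by rewrite scalerA -expr2 sqrr_sign scale1r.
Qed.

Lemma alternate_subsingleton (K : numFieldType) (M : lmodType K) n
    (act : 'S_n -> {linear M -> M}) x :
  is_action act -> (n <= 1)%N -> alternate act x = x.
Proof.
move=> aP n1; apply: alternate_id => s.
have cardS : (#|{: 'S_n}| <= 1)%N.
  by rewrite card_Sn; case: (n) n1 => [|[]].
have -> : s = 1%g by apply: (card_le1_eqP cardS).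
by rewrite aP.1 odd_perm1 scale1r.
Qed.

(** Let y be alternating under the permutations that fix the last number.  The
    cosets of this subgroup are represented by the transpositions of the last
    number with some i, so the alternation of y is the signed mean of its images
    under them.  The transpositions with i not last are conjugate to each other in
    the subgroup, hence contribute equally once F y has been alternated again. *)
Lemma alternate_step (K : numFieldType) (M N : lmodType K) n
    (actM : 'S_n.+2 -> {linear M -> M}) (actN : 'S_n.+1 -> {linear N -> N})
    (F : {linear M -> N}) (y : M) :
  is_action actM -> is_action actN ->
  (forall s x, F (actM (lift_last s) x) = actN s (F x)) ->
  (forall s, actM (lift_last s) y = (-1) ^+ s *: y) ->
  n.+2%:R *: F (alternate actM y) =
    alternate actN (F y)
    - n.+1%:R *: alternate actN
        (F (actM (swap_last n) y)).
Proof.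
move=> aM aN FE yA.
pose tm (i : 'I_n.+2) := tperm i ord_max.
(* the sum over coset representatives is already alternating *)
pose Z := \sum_i (-1) ^+ tm i *: actM (tm i) y.
have ZA : alternating actM Z.
  move=> s; rewrite /Z linear_sum scaler_sumr [RHS](reindex_inj (@perm_inj _ s)).
  apply: eq_bigr => i _; rewrite linearZ /= aM.2.
  pose t := (tm i * s * tm (s i))%g.
  have tmax : t ord_max = ord_max by rewrite /t !permM tpermR tpermL.
  have [t' tE] := lift_lastP tmax.
  have -> : (tm i * s = t * tm (s i))%g by rewrite /t -mulgA tperm2 mulg1.
  rewrite -aM.2 tE yA linearZ /= scalerA scalerA; congr (_ *: _).
  rewrite -(odd_lift_last t') -tE -!signr_addb !odd_permM.
  by case: (odd_perm (tm i)); case: (odd_perm s); case: (odd_perm (tm (s i))).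
have ZE : Z = n.+2%:R *: alternate actM y.
  rewrite -(alternate_id ZA) /Z linear_sum /= (eq_bigr (fun=> alternate actM y)).
    by rewrite sumr_const card_ord scaler_nat.
  move=> i _; rewrite linearZ /= alternate_act //.
  by rewrite scalerA -expr2 sqrr_sign scale1r.
have FZA : alternating actN (F Z).
  by move=> s; rewrite -FE ZA odd_lift_last linearZ.
rewrite -linearZ -ZE -(alternate_id FZA) /Z big_ord_recr /=.
rewrite !linearD /= addrC; congr (_ + _).
  by rewrite /tm tperm1 odd_perm1 scale1r aM.1.
set tau := swap_last n.
rewrite !linear_sum /= (eq_bigr (fun=> - alternate actN (F (actM tau y)))).
  by rewrite sumr_const card_ord mulNrn scaler_nat.
move=> j _.
have -> : widen_ord (leqnSn n.+1) j = lift ord_max j.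
  by apply: val_inj; rewrite /= /bump leqNgt ltn_ord.
pose s := tperm j ord_max : 'S_n.+1.
have tmE : tm (lift ord_max j) = (lift_last s * tau * lift_last s)%g.
  have sV : lift_last s = (lift_last s)^-1%g.
    by rewrite /lift_last lift_permV tpermV.
  rewrite {1}sV -mulgA -[RHS]/(tau ^ lift_last s)%g tpermJ /lift_last.
  by rewrite lift_perm_id lift_perm_lift tpermR.
have odd_tau : tau by rewrite odd_tperm eq_sym neq_lift.
rewrite tmE -!aM.2 yA !odd_permM odd_lift_last odd_tau.
set x := RHS; rewrite addbC addbA addbb /= !linearZ /= FE alternate_act //.
rewrite 2!scalerA expr1 -mulrA -expr2 sqrr_sign mulr1 {}/x.
exact: scaleN1r.
Qed.

(** * Relabelling the operations on graphs *)

Section Relabelling.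
Variables (V : finType) (n p : nat).
Implicit Types (a : {perm V}) (g : graph V n p).

Lemma omap_perm_eq a (x y : option V) : (omap a x == omap a y) = (x == y).
Proof. by case: x y => [x|] [y|] //=; rewrite !eqE /= (inj_eq perm_inj). Qed.

Lemma codom_relabel (I : finType) (a : {perm V}) (f : {ffun I -> V}) v :
  (a v \in codom [ffun i : I => a (f i)]) = (v \in codom f).
Proof.
apply/codomP/codomP => -[i E]; exists i; last by rewrite ffunE E.
by move: E; rewrite ffunE => /perm_inj.
Qed.

Lemma predecessors_relabel a g v w :
  (a w \in predecessors (relabel a g) (a v)) = (w \in predecessors g v).
Proof.
by rewrite !inE /= ffunE permK -[Some (a v)]/(omap a (Some v)) omap_perm_eq.
Qed.

Lemma is_vertex_relabel a g v : is_vertex (relabel a g) (a v) = is_vertex g v.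
Proof. by congr (~~ _); apply: codom_relabel. Qed.

Lemma detached_relabel a g v : detached (relabel a g) (a v) = detached g v.
Proof.
congr (_ && ~~ _); last exact: codom_relabel.
by rewrite /= ffunE permK -[None in LHS]/(omap a None) omap_perm_eq.
Qed.

Lemma perm_roots_relabel a g s :
  perm_roots s (relabel a g) = relabel a (perm_roots s g).
Proof. by apply: graphP => [v|i|i|] //=; rewrite !ffunE. Qed.

Lemma perm_covs_relabel a g s :
  perm_covs s (relabel a g) = relabel a (perm_covs s g).
Proof. by apply: graphP => [v|i|i|] //=; rewrite !ffunE. Qed.

Lemma vertex_to_cov_relabel a g v :
  vertex_to_cov (a v) (relabel a g) = relabel a (vertex_to_cov v g).
Proof.
apply: graphP => [w|i|i|] //=; rewrite !ffunE //.
by case: unlift => // j; rewrite ffunE.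
Qed.

Lemma number_root_relabel a g v :
  number_root (a v) (relabel a g) = relabel a (number_root v g).
Proof.
apply: graphP => [w|i|i|] //=; rewrite !ffunE //.
by case: unlift => // j; rewrite ffunE.
Qed.

Lemma unmark_relabel a g : unmark (relabel a g) = relabel a (unmark g).
Proof. by []. Qed.

Lemma detach_relabel a g v :
  detach (a v) (relabel a g) = relabel a (detach v g).
Proof.
apply: graphP => [w|i|i|] //=; rewrite !ffunE -{1}(permKV a w).
by rewrite predecessors_relabel; case: ifP.
Qed.

End Relabelling.

Lemma attach_last_root_relabel (V : finType) n p (a : {perm V})
    (g : graph V n.+1 p) u :
  attach_last_root (a u) (relabel a g) = relabel a (attach_last_root u g).
Proof.
apply: graphP => [w|i|i|] //=; rewrite !ffunE //.
by rewrite -{1}(permKV a w) (inj_eq perm_inj); case: eqP.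
Qed.

Lemma last_cov_to_vertex_relabel (V : finType) n p (a : {perm V})
    (g : graph V n p.+1) :
  last_cov_to_vertex (relabel a g) = relabel a (last_cov_to_vertex g).
Proof. by apply: graphP => [w|i|i|] //=; rewrite !ffunE. Qed.

Lemma is_forestP (V : finType) n p (g : graph V n p) :
  reflect [/\ injective (root g), injective (cov g),
              forall v, (succ g v == None) = (v \in codom (root g))
            & mark g = None] (is_forest g).
Proof.
apply: (iffP and4P) => -[ri ci sr mg]; split.
- exact/injectiveP.
- exact/injectiveP.
- by move=> v; rewrite (eqP (forallP sr v)).
- exact/eqP.
- exact/injectiveP.
- exact/injectiveP.
- by apply/forallP => v; rewrite sr.
- exact/eqP.
Qed.

Lemma is_forest_relabel (V : finType) n p (a : {perm V}) (g : graph V n p) :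
  is_forest (relabel a g) = is_forest g.
Proof.
have inj_relabel k (f : {ffun 'I_k -> V}) :
    injective [ffun i => a (f i)] <-> injective f.
  split=> fi i j; last by rewrite !ffunE => /perm_inj /fi.
  by move=> E; apply: fi; rewrite !ffunE E.
apply/is_forestP/is_forestP => /= -[/inj_relabel ri /inj_relabel ci sr mg]; split=> //.
- move=> v; have := sr (a v).
  by rewrite codom_relabel ffunE permK -[None in LHS]/(omap a None) omap_perm_eq.
- by case: (mark g) mg.
- move=> v; rewrite -(permKV a v) codom_relabel ffunE permK.
  by rewrite -[None]/(omap a None) omap_perm_eq.
- by rewrite mg.
Qed.

(** * Linear combinations of forests *)

(** Generators, as well as the operators below, are locked so that they are
    handled as abstract vectors and linear maps, through their values on graphs. *)
HB.lock Definition gen (R : realType) m n p (g : graph 'I_m.+1 n p) :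
  lincomb R n p := basis_elt R g.

Section Span.
Variable R : realType.
Implicit Types n p : nat.

Lemma gen_relabel m n p a (g : graph 'I_m.+1 n p) : gen R (relabel a g) = gen R g.
Proof. by rewrite gen.unlock; apply: basis_relabel. Qed.

Lemma lincomb_decomp n p (x : lincomb R n p) :
  x = \sum_(c <- msupp x) x@_c *: gen R (tagged (repr c)).
Proof.
rewrite {1}[x]monalgE; apply: eq_bigr => c _; rewrite gen.unlock /basis_elt.
have -> : cls (tagged (repr c)) = c by rewrite /cls; case: (repr c) (reprK c).
apply/malgP => k; rewrite mcoeffU.
rewrite [RHS]mcoeffZ.
rewrite mcoeffU.
by case: eqP; rewrite ?mulr1n ?mulr0n ?mulr1 ?mulr0.
Qed.

Lemma span_gen m n p (g : graph 'I_m.+1 n p) :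
  is_forest g -> span_forests R n p (gen R g).
Proof.
move=> gf c; rewrite gen.unlock /basis_elt msuppU oner_eq0 inE => /eqP ->.
have fI : invariant (fun m => @is_forest 'I_m.+1 n p).
  by move=> m' a h; apply: is_forest_relabel.
by have := invariant_repr g fI; rewrite gf.
Qed.

Lemma lincomb_ind n p (P : lincomb R n p -> Prop) :
  P 0 -> (forall a x y, P x -> P y -> P (a *: x + y)) ->
  (forall m (g : graph 'I_m.+1 n p), P (gen R g)) ->
  forall x, P x.
Proof.
move=> P0 PD Pb x; rewrite [x]lincomb_decomp.
by elim/big_rec: _ => [|c y _ Py] //; apply: PD.
Qed.

Lemma span_ind n p (P : lincomb R n p -> Prop) :
  P 0 -> (forall a x y, P x -> P y -> P (a *: x + y)) ->
  (forall m (g : graph 'I_m.+1 n p), is_forest g -> P (gen R g)) ->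
  forall x, span_forests R n p x -> P x.
Proof.
move=> P0 PD Pb x xs; rewrite [x]lincomb_decomp big_seq.
elim/big_rec: _ => [|c y cx Py] //; apply: PD => //.
by apply: Pb; exact: xs.
Qed.

Lemma span0 n p : span_forests R n p 0.
Proof. by move=> c; rewrite msupp0. Qed.

Lemma span_lin n p a (x y : lincomb R n p) :
  span_forests R n p x -> span_forests R n p y ->
  span_forests R n p (a *: x + y).
Proof.
move=> xs ys c /(fsubsetP (msuppD_le _ _)); rewrite inE => /orP[|/ys //].
by move/(fsubsetP (msuppZ_le _ _)) => /xs.
Qed.

Lemma spanZ n p a (x : lincomb R n p) :
  span_forests R n p x -> span_forests R n p (a *: x).
Proof. by move=> xs; rewrite -[_ *: _]addr0; apply: span_lin => //; apply: span0. Qed.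

Lemma spanB n p (x y : lincomb R n p) :
  span_forests R n p x -> span_forests R n p y -> span_forests R n p (x - y).
Proof. by move=> xs ys; rewrite addrC -scaleN1r; apply: span_lin. Qed.

Lemma span_sum n p I r (P : pred I) (F : I -> lincomb R n p) :
  (forall i, P i -> span_forests R n p (F i)) ->
  span_forests R n p (\sum_(i <- r | P i) F i).
Proof.
move=> Fs; elim/big_rec: _ => [|i x Pi xs]; first exact: span0.
by rewrite -[F i]scale1r; apply: span_lin => //; apply: Fs.
Qed.

Lemma linear_span n p n' p' (F : {linear lincomb R n p -> lincomb R n' p'}) :
  (forall m (g : graph 'I_m.+1 n p), is_forest g ->
     span_forests R n' p' (F (gen R g))) ->
  forall x, span_forests R n p x -> span_forests R n' p' (F x).
Proof.
move=> Fb; apply: span_ind => [|a x y Fx Fy|//].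
  by rewrite linear0; apply: span0.
by rewrite linearP; apply: span_lin.
Qed.

Lemma eq_linear_span n p (M : lmodType R) (F G : {linear lincomb R n p -> M}) :
  (forall m (g : graph 'I_m.+1 n p), is_forest g -> F (gen R g) = G (gen R g)) ->
  forall x, span_forests R n p x -> F x = G x.
Proof.
move=> FG; apply: span_ind => [|a x y Fx Fy|//]; first by rewrite !linear0.
by rewrite !linearP Fx Fy.
Qed.

End Span.

(** Reduction of an identity both sides of which are linear in [x] to the case of
    a graph, respectively of a forest. *)
Ltac on_graphs x :=
  let IHx := fresh "IHx" in let IHy := fresh "IHy" in
  let m := fresh "m" in let g := fresh "g" in
  elim/lincomb_ind: x => [|? ? ? IHx IHy|m g];
  [by rewrite !linear0|by rewrite !linearP /= IHx IHy|].

Ltac on_forests x xs :=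
  let IHx := fresh "IHx" in let IHy := fresh "IHy" in
  let m := fresh "m" in let g := fresh "g" in let gf := fresh "gf" in
  elim/span_ind: x / xs => [|? ? ? IHx IHy|m g gf];
  [by rewrite !linear0|by rewrite !linearP /= IHx IHy|].

(** * Elementary operators *)

HB.lock Definition root_action (R : realType) n p (s : 'S_n) (x : lincomb R n p) :
  lincomb R n p := linext (fun m g => basis_elt R (perm_roots s g)) x.

HB.lock Definition cov_action (R : realType) n p (s : 'S_p) (x : lincomb R n p) :
  lincomb R n p := linext (fun m g => basis_elt R (perm_covs s g)) x.

HB.lock Definition attach (R : realType) n p (x : lincomb R n.+1 p) :
  lincomb R n p := dH x.

(** The vertical differential before alternation. *)
HB.lock Definition vert (R : realType) n p (x : lincomb R n p) :
  lincomb R n p.+1 :=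
  linext (fun m g =>
    \sum_(v : 'I_m.+1 | is_vertex g v) basis_elt R (vertex_to_cov v g)) x.

HB.lock Definition unvert (R : realType) n p (x : lincomb R n p.+1) :
  lincomb R n p := hV x.

Definition cut_edge (V : finType) n p (w : V) (g : graph V n p) : graph V n.+1 p :=
  Graph [ffun v => if v == w then None else succ g v]
        (extend_last (root g) w) (cov g) (mark g).

(** The contracting counterpart of [attach]: it reverses the attachment of the
    last root to the last covertex. *)
HB.lock Definition cut (R : realType) n p (x : lincomb R n p.+1) :
  lincomb R n.+1 p.+1 :=
  linext (fun m g =>
    \sum_(w : 'I_m.+1 | w \in predecessors g (cov g ord_max))
      basis_elt R (cut_edge w g)) x.

Section Linearity.
Variable R : realType.
Implicit Types n p : nat.

Lemma root_action_is_linear n p s : linear (@root_action R n p s).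
Proof. by move=> a x y; rewrite root_action.unlock; exact: linearP. Qed.
HB.instance Definition _ n p s :=
  GRing.isLinear.Build R (lincomb R n p) (lincomb R n p) _ _
    (@root_action_is_linear n p s).

Lemma cov_action_is_linear n p s : linear (@cov_action R n p s).
Proof. by move=> a x y; rewrite cov_action.unlock; exact: linearP. Qed.
HB.instance Definition _ n p s :=
  GRing.isLinear.Build R (lincomb R n p) (lincomb R n p) _ _
    (@cov_action_is_linear n p s).

Lemma attach_is_linear n p : linear (@attach R n p).
Proof. by move=> a x y; rewrite attach.unlock; exact: linext_is_linear. Qed.
HB.instance Definition _ n p :=
  GRing.isLinear.Build R (lincomb R n.+1 p) (lincomb R n p) _ _
    (@attach_is_linear n p).

Lemma vert_is_linear n p : linear (@vert R n p).
Proof. by move=> a x y; rewrite vert.unlock; exact: linearP. Qed.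
HB.instance Definition _ n p :=
  GRing.isLinear.Build R (lincomb R n p) (lincomb R n p.+1) _ _
    (@vert_is_linear n p).

Lemma unvert_is_linear n p : linear (@unvert R n p).
Proof. by move=> a x y; rewrite unvert.unlock; exact: linext_is_linear. Qed.
HB.instance Definition _ n p :=
  GRing.isLinear.Build R (lincomb R n p.+1) (lincomb R n p) _ _
    (@unvert_is_linear n p).

Lemma cut_is_linear n p : linear (@cut R n p).
Proof. by move=> a x y; rewrite cut.unlock; exact: linearP. Qed.
HB.instance Definition _ n p :=
  GRing.isLinear.Build R (lincomb R n p.+1) (lincomb R n.+1 p.+1) _ _
    (@cut_is_linear n p).

End Linearity.

Section OnGraphs.
Variable R : realType.
Implicit Types n p : nat.

Lemma root_action_gen m n p s (g : graph 'I_m.+1 n p) :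
  root_action s (gen R g) = gen R (perm_roots s g).
Proof.
rewrite gen.unlock root_action.unlock; apply: linext_basis => k a h.
by rewrite perm_roots_relabel; apply: basis_relabel.
Qed.

Lemma cov_action_gen m n p s (g : graph 'I_m.+1 n p) :
  cov_action s (gen R g) = gen R (perm_covs s g).
Proof.
rewrite gen.unlock cov_action.unlock; apply: linext_basis => k a h.
by rewrite perm_covs_relabel; apply: basis_relabel.
Qed.

Lemma attach_gen m n p (g : graph 'I_m.+1 n.+1 p) :
  attach (gen R g) = \sum_u gen R (attach_last_root u g).
Proof.
rewrite gen.unlock attach.unlock; apply: linext_basis => k a h.
rewrite (reindex_inj (@perm_inj _ a)) /=; apply: eq_bigr => u _.
by rewrite attach_last_root_relabel; apply: basis_relabel.
Qed.

Lemma vert_gen m n p (g : graph 'I_m.+1 n p) :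
  vert (gen R g) = \sum_(v | is_vertex g v) gen R (vertex_to_cov v g).
Proof.
rewrite gen.unlock vert.unlock; apply: linext_basis => k a h.
rewrite (reindex_inj (@perm_inj _ a)) /=; apply: eq_big => u.
  exact: is_vertex_relabel.
by move=> _; rewrite vertex_to_cov_relabel; apply: basis_relabel.
Qed.

Lemma unvert_gen m n p (g : graph 'I_m.+1 n p.+1) :
  unvert (gen R g) = (p.+1%:R / m.+1%:R) *: gen R (last_cov_to_vertex g).
Proof.
rewrite (_ : m.+1%:R = #|'I_m.+1|%:R); last by rewrite card_ord.
rewrite gen.unlock unvert.unlock.
apply: (linext_basis (f := fun m g => (p.+1%:R / #|'I_m.+1|%:R) *:
  basis_elt R (last_cov_to_vertex g))) => k a h.
by rewrite last_cov_to_vertex_relabel basis_relabel.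
Qed.

Lemma cut_edge_relabel (V : finType) n p (a : {perm V}) (g : graph V n p) v :
  cut_edge (a v) (relabel a g) = relabel a (cut_edge v g).
Proof.
apply: graphP => [w|i|i|] //=; rewrite !ffunE.
  by rewrite -{1}(permKV a w) (inj_eq perm_inj); case: eqP.
by case: unlift => // j; rewrite ffunE.
Qed.

Lemma cut_gen m n p (g : graph 'I_m.+1 n p.+1) :
  cut (gen R g) =
  \sum_(w | w \in predecessors g (cov g ord_max)) gen R (cut_edge w g).
Proof.
rewrite gen.unlock cut.unlock; apply: linext_basis => k a h.
rewrite (reindex_inj (@perm_inj _ a)) /=; apply: eq_big => u.
  by rewrite ffunE; apply: predecessors_relabel.
by move=> _; rewrite cut_edge_relabel; apply: basis_relabel.
Qed.

End OnGraphs.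

(** * Equivariance *)

Section ExtendLast.
Variables (V : finType) (n : nat).
Implicit Types (f : {ffun 'I_n -> V}) (s : 'S_n) (v w : V).

Lemma extend_last_max f v : extend_last f v ord_max = v.
Proof. by rewrite ffunE unlift_none. Qed.

Lemma extend_last_lift f v i : extend_last f v (lift ord_max i) = f i.
Proof. by rewrite ffunE liftK. Qed.

Lemma eq_extend_last (h h' : {ffun 'I_n.+1 -> V}) :
  h ord_max = h' ord_max ->
  (forall i, h (lift ord_max i) = h' (lift ord_max i)) -> h =1 h'.
Proof. by move=> em el i; case: (unliftP ord_max i) => [j|] ->. Qed.

Lemma extend_last_perm f v s :
  [ffun i => extend_last f v (((lift_last s)^-1)%g i)] =1
  extend_last [ffun i => f ((s^-1)%g i)] v.
Proof.
apply: eq_extend_last => [|i]; rewrite ffunE /lift_last lift_permV.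
  by rewrite lift_perm_id !extend_last_max.
by rewrite lift_perm_lift !extend_last_lift ffunE.
Qed.

Lemma drop_last_perm (h : {ffun 'I_n.+1 -> V}) s :
  drop_last [ffun i => h (((lift_last s)^-1)%g i)] =1
  [ffun i => drop_last h ((s^-1)%g i)].
Proof. by move=> i; rewrite !ffunE /lift_last lift_permV lift_perm_lift. Qed.

Lemma codom_perm f s v :
  (v \in codom [ffun i => f ((s^-1)%g i)]) = (v \in codom f).
Proof.
apply/codomP/codomP => -[i ->]; last by exists (s i); rewrite ffunE permK.
by exists ((s^-1)%g i); rewrite ffunE.
Qed.

Lemma codom_extend_last f w v :
  (v \in codom (extend_last f w)) = (v == w) || (v \in codom f).
Proof.
apply/codomP/orP => [[i ->]|[/eqP ->|/codomP[i ->]]].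
- case: (unliftP ord_max i) => [j|] ->; last by left; rewrite extend_last_max.
  by right; rewrite extend_last_lift; apply: codom_f.
- by exists ord_max; rewrite extend_last_max.
- by exists (lift ord_max i); rewrite extend_last_lift.
Qed.

Lemma inj_extend_last f w :
  injective f -> w \notin codom f -> injective (extend_last f w).
Proof.
move=> fI wf i j.
case: (unliftP ord_max i) => [i'|] ->; case: (unliftP ord_max j) => [j'|] -> //;
  rewrite ?extend_last_max ?extend_last_lift => E.
- by rewrite (fI _ _ E).
- by rewrite -E codom_f in wf.
- by rewrite E codom_f in wf.
Qed.

Lemma inj_drop_last (h : {ffun 'I_n.+1 -> V}) :
  injective h -> injective (drop_last h).
Proof. by move=> hI i j; rewrite !ffunE => /hI /lift_inj. Qed.

Lemma codom_drop_last (h : {ffun 'I_n.+1 -> V}) v :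
  injective h ->
  (v \in codom (drop_last h)) = (v != h ord_max) && (v \in codom h).
Proof.
move=> hI; apply/codomP/andP => [[i ->]|[vm /codomP[i vi]]].
  by rewrite ffunE codom_f (inj_eq hI) eq_sym neq_lift.
case: (unliftP ord_max i) vi vm => [j|] -> ->; last by rewrite eqxx.
by exists j; rewrite ffunE.
Qed.

End ExtendLast.

Section Equivariance.
Variable R : realType.
Implicit Types n p : nat.

Lemma root_action_is_action n p : is_action (fun s => @root_action R n p s).
Proof.
split=> [x|s t x] /=; on_graphs x; rewrite !root_action_gen; congr (gen R _).
  by apply: graphP => //= i; rewrite ffunE invg1 perm1.
by apply: graphP => //= i; rewrite !ffunE invMg permM.
Qed.

Lemma cov_action_is_action n p : is_action (fun s => @cov_action R n p s).
Proof.
split=> [x|s t x] /=; on_graphs x; rewrite !cov_action_gen; congr (gen R _).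
  by apply: graphP => //= i; rewrite ffunE invg1 perm1.
by apply: graphP => //= i; rewrite !ffunE invMg permM.
Qed.

Lemma root_cov_action n p s t (x : lincomb R n p) :
  root_action s (cov_action t x) = cov_action t (root_action s x).
Proof. by on_graphs x; rewrite !(root_action_gen, cov_action_gen). Qed.

Lemma attach_root_action n p s (x : lincomb R n.+1 p) :
  attach (root_action (lift_last s) x) = root_action s (attach x).
Proof.
on_graphs x; rewrite root_action_gen !attach_gen linear_sum.
apply: eq_bigr => u _; rewrite /= root_action_gen; congr (gen R _).
apply: graphP => //= [v|i]; last exact: drop_last_perm.
by rewrite !ffunE /lift_last lift_permV lift_perm_id.
Qed.

Lemma attach_cov_action n p t (x : lincomb R n.+1 p) :
  attach (cov_action t x) = cov_action t (attach x).
Proof.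
on_graphs x; rewrite cov_action_gen !attach_gen linear_sum.
by apply: eq_bigr => u _; rewrite /= cov_action_gen.
Qed.

Lemma vert_root_action n p s (x : lincomb R n p) :
  vert (root_action s x) = root_action s (vert x).
Proof.
on_graphs x; rewrite root_action_gen !vert_gen linear_sum.
by apply: eq_bigr => u _; rewrite /= root_action_gen.
Qed.

Lemma vert_cov_action n p t (x : lincomb R n p) :
  vert (cov_action t x) = cov_action (lift_last t) (vert x).
Proof.
on_graphs x; rewrite cov_action_gen !vert_gen linear_sum.
apply: eq_big => [v|v _]; first by congr (~~ _); apply: codom_perm.
rewrite /= cov_action_gen; congr (gen R _); apply: graphP => //= i.
by rewrite extend_last_perm.
Qed.

Lemma unvert_root_action n p s (x : lincomb R n p.+1) :
  unvert (root_action s x) = root_action s (unvert x).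
Proof.
by on_graphs x; rewrite root_action_gen !unvert_gen linearZ /= root_action_gen.
Qed.

Lemma unvert_cov_action n p t (x : lincomb R n p.+1) :
  unvert (cov_action (lift_last t) x) = cov_action t (unvert x).
Proof.
on_graphs x; rewrite cov_action_gen !unvert_gen linearZ /= cov_action_gen.
congr (_ *: gen R _); apply: graphP => //=; exact: drop_last_perm.
Qed.

Lemma cut_root_action n p s (x : lincomb R n p.+1) :
  cut (root_action s x) = root_action (lift_last s) (cut x).
Proof.
on_graphs x; rewrite root_action_gen !cut_gen linear_sum.
apply: eq_bigr => w _; rewrite /= root_action_gen; congr (gen R _).
by apply: graphP => //= i; rewrite extend_last_perm.
Qed.

Lemma attach_vert n p (x : lincomb R n.+1 p) :
  attach (vert x) = vert (attach x).
Proof.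
on_graphs x; rewrite attach_gen vert_gen !linear_sum /=.
rewrite (eq_bigr _ (fun v _ => attach_gen R (vertex_to_cov v g))) exchange_big /=.
by apply: eq_bigr => u _; rewrite vert_gen.
Qed.

Lemma attach_unvert n p (x : lincomb R n.+1 p.+1) :
  attach (unvert x) = unvert (attach x).
Proof.
on_graphs x; rewrite attach_gen unvert_gen linearZ linear_sum /= attach_gen.
by rewrite scaler_sumr; apply: eq_bigr => u _; rewrite unvert_gen.
Qed.

End Equivariance.

(** * Operators preserve forests *)

Section Stability.
Variable R : realType.
Implicit Types n p : nat.

Lemma span_root_action n p s (x : lincomb R n p) :
  span_forests R n p x -> span_forests R n p (root_action s x).
Proof.
apply: linear_span => m g /is_forestP [ri ci sr mg] /=; rewrite root_action_gen.
apply/span_gen/is_forestP; split=> //= [i j|v].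
  by rewrite !ffunE => /ri /perm_inj.
by rewrite sr; symmetry; apply: codom_perm.
Qed.

Lemma span_cov_action n p s (x : lincomb R n p) :
  span_forests R n p x -> span_forests R n p (cov_action s x).
Proof.
apply: linear_span => m g /is_forestP [ri ci sr mg] /=; rewrite cov_action_gen.
apply/span_gen/is_forestP; split=> //= i j.
by rewrite !ffunE => /ci /perm_inj.
Qed.

Lemma attach_last_root_forest (V : finType) n p (g : graph V n.+1 p) u :
  is_forest g -> is_forest (attach_last_root u g).
Proof.
move=> /is_forestP [ri ci sr mg]; apply/is_forestP; split=> //=.
  exact: inj_drop_last.
by move=> v; rewrite codom_drop_last // ffunE -sr; case: (v == _).
Qed.

Lemma span_attach n p (x : lincomb R n.+1 p) :
  span_forests R n.+1 p x -> span_forests R n p (attach x).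
Proof.
apply: linear_span => m g gf /=; rewrite attach_gen.
by apply: span_sum => u _; apply/span_gen/attach_last_root_forest.
Qed.

Lemma span_vert n p (x : lincomb R n p) :
  span_forests R n p x -> span_forests R n p.+1 (vert x).
Proof.
apply: linear_span => m g /is_forestP [ri ci sr mg] /=; rewrite vert_gen.
apply: span_sum => v vv; apply/span_gen/is_forestP; split=> //=.
exact: inj_extend_last.
Qed.

Lemma span_unvert n p (x : lincomb R n p.+1) :
  span_forests R n p.+1 x -> span_forests R n p (unvert x).
Proof.
apply: linear_span => m g /is_forestP [ri ci sr mg] /=; rewrite unvert_gen.
apply/spanZ/span_gen/is_forestP; split=> //=; exact: inj_drop_last.
Qed.

Lemma cut_edge_forest (V : finType) n p (g : graph V n p) w :
  is_forest g -> succ g w != None -> is_forest (cut_edge w g).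
Proof.
move=> /is_forestP [ri ci sr mg] sw; apply/is_forestP; split=> //=.
  by apply: inj_extend_last; rewrite // -sr.
by move=> v; rewrite codom_extend_last ffunE -sr; case: (v == w).
Qed.

Lemma span_cut n p (x : lincomb R n p.+1) :
  span_forests R n p.+1 x -> span_forests R n.+1 p.+1 (cut x).
Proof.
apply: linear_span => m g gf /=; rewrite cut_gen.
apply: span_sum => w; rewrite inE /= => /eqP sw.
by apply/span_gen/cut_edge_forest => //; rewrite sw.
Qed.

End Stability.

(** * Alternating combinations of forests *)

Notation alt_roots := (alternate (fun s => @root_action _ _ _ s)).
Notation alt_covs := (alternate (fun s => @cov_action _ _ _ s)).
Notation root_alternating := (alternating (fun s => @root_action _ _ _ s)).
Notation cov_alternating := (alternating (fun s => @cov_action _ _ _ s)).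

Section Omega.
Variable R : realType.
Implicit Types n p : nat.

Lemma wedge_rootE n p (x : lincomb R n p) : wedge_root x = alt_roots x.
Proof.
elim/lincomb_ind: x => [|a x y IHx IHy|m g].
- by rewrite [RHS]linear0; exact: linear0.
- by rewrite [RHS]linearP /= -IHx -IHy; exact: linext_is_linear.
transitivity (n`!%:R^-1 *: \sum_(s : 'S_n) (-1) ^+ s *: gen R (perm_roots s g)).
  2: rewrite alternate.unlock; apply: congr1; apply: eq_bigr => s _ /=.
  2: by rewrite root_action_gen.
rewrite gen.unlock /wedge_root; apply: linext_basis => k a h; apply: congr1.
by apply: eq_bigr => s _; rewrite perm_roots_relabel basis_relabel.
Qed.

Lemma wedge_covE n p (x : lincomb R n p) : wedge_cov x = alt_covs x.
Proof.
elim/lincomb_ind: x => [|a x y IHx IHy|m g].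
- by rewrite [RHS]linear0; exact: linear0.
- by rewrite [RHS]linearP /= -IHx -IHy; exact: linext_is_linear.
transitivity (p`!%:R^-1 *: \sum_(s : 'S_p) (-1) ^+ s *: gen R (perm_covs s g)).
  2: rewrite alternate.unlock; apply: congr1; apply: eq_bigr => s _ /=.
  2: by rewrite cov_action_gen.
rewrite gen.unlock /wedge_cov; apply: linext_basis => k a h; apply: congr1.
by apply: eq_bigr => s _; rewrite perm_covs_relabel basis_relabel.
Qed.

Lemma wedgeE n p (x : lincomb R n p) : wedge x = alt_roots (alt_covs x).
Proof. by rewrite /wedge wedge_covE wedge_rootE. Qed.

(** The two symmetric groups permute different numbers. *)
Lemma alt_rootsC n p (x : lincomb R n p) :
  alt_roots (alt_covs x) = alt_covs (alt_roots x).
Proof.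
apply: alternate_equivariant => s y /=.
rewrite -(alternate_equivariant (actM := fun s => @root_action R n p s)
  (F := @cov_action R n p s)) // => t z; exact: esym (root_cov_action _ _ _).
Qed.

Lemma span_alternate n p k (act : 'S_k -> {linear lincomb R n p -> lincomb R n p}) x :
  (forall s y, span_forests R n p y -> span_forests R n p (act s y)) ->
  span_forests R n p x -> span_forests R n p (alternate act x).
Proof.
move=> actS xs; rewrite alternate.unlock; apply/spanZ/span_sum => s _.
exact/spanZ/actS.
Qed.

Lemma span_alt_roots n p (x : lincomb R n p) :
  span_forests R n p x -> span_forests R n p (alt_roots x).
Proof. by apply: span_alternate => s y; apply: span_root_action. Qed.

Lemma span_alt_covs n p (x : lincomb R n p) :
  span_forests R n p x -> span_forests R n p (alt_covs x).
Proof. by apply: span_alternate => s y; apply: span_cov_action. Qed.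

Lemma OmegaP n p (x : lincomb R n p) :
  Omega R n p x <->
  [/\ span_forests R n p x, root_alternating x & cov_alternating x].
Proof.
split=> [[y ys <-]|[xs xr xc]]; last first.
  by exists x => //; rewrite wedgeE !alternate_id.
rewrite wedgeE; split; first exact/span_alt_roots/span_alt_covs.
  exact/alternating_alternate/root_action_is_action.
rewrite alt_rootsC; exact/alternating_alternate/cov_action_is_action.
Qed.

Lemma Omega_wedge n p (x : lincomb R n p) :
  span_forests R n p x -> Omega R n p (wedge x).
Proof. by exists x. Qed.

Lemma Omega_span n p (x : lincomb R n p) : Omega R n p x -> span_forests R n p x.
Proof. by case/OmegaP. Qed.

Lemma wedge_few_roots n p (x : lincomb R n p) : (n <= 1)%N -> wedge x = alt_covs x.
Proof.
by move=> n1; rewrite wedgeE alternate_subsingleton //; apply: root_action_is_action.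
Qed.

Lemma dHE n p (x : lincomb R n.+1 p) : dH x = attach x.
Proof. by rewrite attach.unlock. Qed.

Lemma hVE n p (x : lincomb R n p.+1) : hV x = unvert x.
Proof. by rewrite unvert.unlock. Qed.

Lemma dVE n p (x : lincomb R n p) : dV x = wedge (vert x).
Proof. by rewrite vert.unlock. Qed.

Lemma alternating_attach n p (x : lincomb R n.+1 p) :
  root_alternating x -> root_alternating (attach x).
Proof.
by move=> xr s /=; rewrite -attach_root_action xr odd_lift_last linearZ.
Qed.

Lemma Omega_dH n p (x : lincomb R n.+1 p) : Omega R n.+1 p x -> Omega R n p (dH x).
Proof.
case/OmegaP=> xs xr xc; rewrite dHE; apply/OmegaP; split.
- exact: span_attach.
- exact: alternating_attach.
- by move=> t /=; rewrite -attach_cov_action xc linearZ.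
Qed.

Lemma Omega_dV n p (x : lincomb R n p) : Omega R n p x -> Omega R n p.+1 (dV x).
Proof. by case/OmegaP=> xs xr xc; rewrite dVE; apply/Omega_wedge/span_vert. Qed.

Lemma Omega_hV n p (x : lincomb R n p.+1) : Omega R n p.+1 x -> Omega R n p (hV x).
Proof.
case/OmegaP=> xs xr xc; rewrite hVE; apply/OmegaP; split.
- exact: span_unvert.
- by move=> s /=; rewrite -unvert_root_action xr linearZ.
- by move=> t /=; rewrite -unvert_cov_action xc odd_lift_last linearZ.
Qed.

End Omega.

(** * The vertical complex *)

Section Vertical.
Variable R : realType.
Implicit Types n p : nat.

Lemma is_vertexE (V : finType) n p (g : graph V n p) v :
  is_vertex g v = (v \notin codom (cov g)).
Proof. by []. Qed.

Lemma is_vertex_vertex_to_cov (V : finType) n p (g : graph V n p) v w :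
  is_vertex (vertex_to_cov v g) w = (w != v) && is_vertex g w.
Proof. by rewrite !is_vertexE codom_extend_last negb_or. Qed.

Lemma is_vertex_last_cov_to_vertex (V : finType) n p (g : graph V n p.+1) w :
  injective (cov g) ->
  is_vertex (last_cov_to_vertex g) w = (w == cov g ord_max) || is_vertex g w.
Proof. by move=> ci; rewrite !is_vertexE codom_drop_last // negb_and negbK. Qed.

(** Two vertices are turned into the last two covertices in either order. *)
Lemma cov_action_vert_vert n p (x : lincomb R n p) :
  cov_action (swap_last p) (vert (vert x)) = vert (vert x).
Proof.
on_graphs x; rewrite vert_gen !linear_sum /=.
rewrite (eq_bigr _ (fun v _ => vert_gen R (vertex_to_cov v g))).
rewrite [RHS](exchange_big_dep (is_vertex g)) => [|v w vv] /=; last first.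
  by rewrite is_vertex_vertex_to_cov => /andP[].
apply: eq_bigr => v vv; rewrite vert_gen linear_sum /=.
apply: eq_big => w; first by rewrite !is_vertex_vertex_to_cov vv andbT eq_sym andbC.
move=> _; rewrite cov_action_gen; congr (gen R _); apply: graphP => //= i.
rewrite ffunE tpermV; move: i; apply: eq_ord_last_two => [||i].
- by rewrite tpermR extend_last_lift !extend_last_max.
- by rewrite tpermL extend_last_lift !extend_last_max.
- by rewrite swap_last_lift !extend_last_lift.
Qed.

Lemma eq_oppr_eq0 n p (x : lincomb R n p) : x = - x -> x = 0.
Proof.
move=> xN; apply: (scalerI (a := 2%:R)); first by rewrite pnatr_eq0.
by rewrite scaler0 scaler_nat mulr2n {1}xN addNr.
Qed.

Lemma dV_E n p (x : lincomb R n p) :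
  root_alternating x -> dV x = alt_covs (vert x).
Proof.
move=> xr; rewrite dVE wedgeE alt_rootsC; congr (alternate _ _).
by apply: alternate_id => s /=; rewrite -vert_root_action xr linearZ.
Qed.

Lemma dV_dV n p (x : lincomb R n p) : Omega R n p x -> dV (dV x) = 0.
Proof.
move=> xO; have [_ xr _] := (OmegaP _).1 xO.
have [_ yr _] := (OmegaP _).1 (Omega_dV xO).
rewrite dV_E // dV_E // (alternate_absorb _ (cov_action_is_action R n p.+2)) //.
  apply: eq_oppr_eq0 => /=; rewrite -{1}cov_action_vert_vert.
  rewrite (alternate_act (cov_action_is_action R n p.+2)).
  by rewrite odd_tperm eq_sym neq_lift expr1 scaleN1r.
by move=> s y /=; apply: vert_cov_action.
Qed.

Lemma unvert_vert n (x : lincomb R n 0) :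
  span_forests R n 0 x -> unvert (vert x) = x.
Proof.
move=> xs; on_forests x xs; rewrite vert_gen linear_sum /=.
rewrite (eq_bigl xpredT) => [|v]; last by rewrite is_vertexE; apply/codomP => -[[]].
rewrite (eq_bigr (fun=> m.+1%:R^-1 *: gen R g)) => [|v _].
  rewrite sumr_const card_ord -scaler_nat scalerA mulfV ?scale1r //.
  by rewrite pnatr_eq0.
rewrite unvert_gen mul1r; congr (_ *: gen R _).
by apply: graphP => //= -[].
Qed.

Lemma hV_dV n (x : lincomb R n 0) : Omega R n 0 x -> hV (dV x) = x.
Proof.
move=> /OmegaP[xs xr _]; rewrite dV_E // alternate_subsingleton //.
  by rewrite hVE unvert_vert.
exact: cov_action_is_action.
Qed.

Lemma linear_comb3 (K : fieldType) (M N : lmodType K) (F : {linear M -> N}) a b x y z :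
  F (x - a *: y + b *: z) = F x - a *: F y + b *: F z.
Proof. by rewrite linearD linearB !linearZ. Qed.

Lemma vertical_balance_arith (K : fieldType) (M : lmodType K) (x y : M) (a b c : K) :
  b != 0 ->
  (c / b * (b - a)) *: x - a *: ((c / b) *: y) + c *: ((a / b) *: (x + y)) = c *: x.
Proof.
move=> b0; rewrite !scalerA scalerDr (mulrCA c) addrACA addNr addr0 -scalerDl.
by rewrite (mulrC a) -mulrDr subrK mulfVK.
Qed.

(** On a forest, let S be the sum over the vertices v of the graphs where v takes
    the number of the last covertex c, which becomes a vertex.  The second and
    third terms contain S with opposite coefficients, and the coefficients of the
    forest itself add up because its nodes are its vertices and covertices. *)
Lemma vertical_balance n p (x : lincomb R n p.+1) :
  span_forests R n p.+1 x ->
  unvert (vert x)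
  - p.+1%:R *: unvert (cov_action (swap_last p) (vert x))
  + p.+2%:R *: vert (unvert x) = p.+2%:R *: x.
Proof.
apply: (eq_linear_span
  (F := ((@unvert R n p.+1 \o @vert R n p.+1)
    \- p.+1%:R \*: (@unvert R n p.+1 \o
         (@cov_action R n p.+2 (swap_last p) \o @vert R n p.+1)))
    \+ p.+2%:R \*: (@vert R n p \o @unvert R n p))
  (G := p.+2%:R \*: idfun)) => m g /is_forestP[_ ci _ _] /=.
set c := cov g ord_max.
pose swap v := Graph (succ g) (root g) (extend_last (drop_last (cov g)) v) (mark g).
have count : #|is_vertex g|%:R = m.+1%:R - p.+1%:R :> R.
  have E := cardC (mem (codom (cov g))); rewrite card_codom // !card_ord in E.
  by apply: (canRL (addrK _)); rewrite -natrD addnC E.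
have -> : unvert (vert (gen R g)) =
    (p.+2%:R / m.+1%:R * (m.+1%:R - p.+1%:R)) *: gen R g.
  rewrite vert_gen linear_sum /=.
  rewrite (eq_bigr (fun=> (p.+2%:R / m.+1%:R) *: gen R g)) => [|v _].
    by rewrite sumr_const -scaler_nat scalerA mulrC count.
  rewrite unvert_gen; congr (_ *: gen R _).
  by apply: graphP => //= i; rewrite ffunE extend_last_lift.
have -> : unvert (cov_action (swap_last p) (vert (gen R g))) =
    (p.+2%:R / m.+1%:R) *: \sum_(v | is_vertex g v) gen R (swap v).
  rewrite vert_gen !linear_sum; apply: eq_bigr => v _ /=.
  rewrite cov_action_gen unvert_gen; congr (_ *: gen R _).
  apply: graphP => //=; apply: eq_extend_last => [|i].
    by rewrite !ffunE tpermV tpermL !unlift_none.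
  by rewrite extend_last_lift !ffunE tpermV swap_last_lift liftK.
have -> : vert (unvert (gen R g)) =
    (p.+1%:R / m.+1%:R) *: (gen R g + \sum_(v | is_vertex g v) gen R (swap v)).
  rewrite unvert_gen linearZ /= vert_gen; congr (_ *: _).
  rewrite (bigD1 c) /=; last by rewrite is_vertex_last_cov_to_vertex ?eqxx.
  congr (_ + _).
    congr (gen R _); apply: graphP => //=; apply: eq_extend_last => [|i].
      by rewrite extend_last_max.
    by rewrite extend_last_lift ffunE.
  apply: eq_big => v //; rewrite is_vertex_last_cov_to_vertex //.
  case: (eqVneq v c) => [->|_]; last by rewrite andbT.
  by rewrite andbF is_vertexE codom_f.
by apply: vertical_balance_arith; rewrite pnatr_eq0.
Qed.

(** [alternate_step] turns the alternation inside [hV (dV x)] into the terms of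
    [vertical_balance]. *)
Lemma vertical_homotopy n p (x : lincomb R n p.+1) :
  Omega R n p.+1 x -> hV (dV x) + dV (hV x) = x.
Proof.
move=> xO; have [xs xr xc] := (OmegaP _).1 xO.
have [_ yr _] := (OmegaP _).1 (Omega_hV xO).
have p2 : p.+2%:R != 0 :> R by rewrite pnatr_eq0.
apply: (scalerI p2).
have step := alternate_step (F := @unvert R n p.+1) (y := vert x)
  (cov_action_is_action R n p.+2) (cov_action_is_action R n p.+1).
rewrite scalerDr !dV_E // !hVE step //=.
- by rewrite -linear_comb3 vertical_balance // linearZ /= (alternate_id xc).
- by move=> s y; apply: unvert_cov_action.
- by move=> s; rewrite -vert_cov_action xc linearZ.
Qed.

Lemma dH_dV n p (x : lincomb R n.+1 p) :
  Omega R n.+1 p x -> dH (dV x) = dV (dH x).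
Proof.
move=> xO; have [_ xr _] := (OmegaP _).1 xO.
have [_ yr _] := (OmegaP _).1 (Omega_dH xO).
rewrite !dV_E // !dHE -attach_vert.
by apply: alternate_equivariant => s y; apply: attach_cov_action.
Qed.

Lemma dH_hV n p (x : lincomb R n.+1 p.+1) : dH (hV x) = hV (dH x).
Proof. by rewrite !dHE !hVE attach_unvert. Qed.

End Vertical.

(** * Rows with roots *)

Section Peel.
Variables (K : fieldType) (M : lmodType K) (N : {linear M -> M}).

(** The product of the N - j for j < k: it annihilates the vectors on which N acts
    triangularly with distinct diagonal entries among the natural numbers below k. *)
Fixpoint peel (k : nat) (x : M) : M :=
  if k is k'.+1 then peel k' (N x - k'%:R *: x) else x.

Lemma peel_is_linear k : linear (peel k).
Proof.
elim: k => //= k IHk a x y; rewrite -IHk; congr peel.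
by rewrite linearP scalerDr opprD addrACA scalerBr !scalerA (mulrC a).
Qed.
HB.instance Definition _ k := GRing.isLinear.Build K M M _ _ (peel_is_linear k).

Lemma subZ_linearN (P : lmodType K) (F : {linear M -> P}) k u x :
  u - k *: F (- x) = u + k *: F x.
Proof. by rewrite linearN scalerN opprK. Qed.

Lemma scale_out a b c (x y : M) :
  a *: (b *: (c *: x) - c *: y) = c *: (a *: (b *: x - y)).
Proof. by rewrite (scalerA b) (mulrC b) -scalerA -scalerBr scalerA mulrC -scalerA. Qed.

End Peel.

Section Horizontal.
Variable R : realType.
Implicit Types n p : nat.

(** The last two roots are attached independently of each other. *)
Lemma attach_attach n p (x : lincomb R n.+2 p) :
  span_forests R n.+2 p x ->
  attach (attach (root_action (swap_last n) x)) = attach (attach x).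
Proof.
move=> xs; on_forests x xs; have [ri _ _ _] := is_forestP _ gf.
rewrite root_action_gen !attach_gen !linear_sum /=.
rewrite (eq_bigr _ (fun u _ => attach_gen R (attach_last_root u _))) exchange_big /=.
apply: eq_bigr => u _; rewrite attach_gen; apply: eq_bigr => v _.
congr (gen R _); apply: graphP => //= [w|i]; rewrite !ffunE tpermV.
  rewrite tpermR tpermL; case: eqP => [->|_] //.
  by rewrite (inj_eq ri) (negPf (neq_lift _ _)).
by rewrite swap_last_lift.
Qed.

Lemma dH_dH n p (x : lincomb R n.+2 p) : Omega R n.+2 p x -> dH (dH x) = 0.
Proof.
move=> /OmegaP[xs xr _]; rewrite !dHE; apply: eq_oppr_eq0.
rewrite -{1}attach_attach //.
by rewrite xr odd_tperm eq_sym neq_lift expr1 scaleN1r !linearN.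
Qed.

(** The predecessors of the last covertex c after attaching the last root r are
    the old ones and, if r is attached to c, r itself.  Cutting at r restores the
    forest; cutting at an old predecessor w commutes with attaching r, except that
    r, the last root at first, is the next to last one once w is a root. *)
Lemma cut_attach n p (x : lincomb R n.+1 p.+1) :
  span_forests R n.+1 p.+1 x ->
  cut (attach x) = x + attach (root_action (swap_last n) (cut x)).
Proof.
move=> xs; elim/span_ind: x / xs => [|a x y IHx IHy|m g gf].
- by rewrite !linear0 addr0.
- by rewrite !linearP /= IHx IHy scalerDr addrACA.
have [ri _ sr _] := is_forestP _ gf.
set c := cov g ord_max; set r := root g ord_max.
have sr0 : succ g r = None by apply/eqP; rewrite sr codom_f.
pose P := predecessors g c.
have rP : r \notin P by rewrite !inE sr0.
have predE u w : (w \in predecessors (attach_last_root u g) c) =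
    (if w == r then u == c else w \in P).
  by rewrite [LHS]inE /= ffunE -/r; case: ifP.
have cutr : cut_edge r (attach_last_root c g) = g.
  apply: graphP => //= [v|]; first by rewrite !ffunE; case: eqP => [->|].
  apply: eq_extend_last => [|i]; first by rewrite extend_last_max.
  by rewrite extend_last_lift ffunE.
transitivity (\sum_u ((if u == c then gen R g else 0) +
    \sum_(w in P) gen R (cut_edge w (attach_last_root u g)))).
  rewrite attach_gen linear_sum; apply: eq_bigr => u _ /=.
  rewrite cut_gen [cov _ _]/= -/c (eq_bigl _ _ (predE u)).
  case: (eqVneq u c) => [->|uc].
    rewrite (bigD1 r) /= ?eqxx // cutr; congr (_ + _).
    apply: eq_bigl => w; case: (eqVneq w r) => [->|_]; last by rewrite andbT.
    by rewrite andbF (negPf rP).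
  rewrite add0r; apply: eq_bigl => w; case: (eqVneq w r) => [->|//].
  by rewrite (negPf rP).
rewrite big_split /= -big_mkcond big_pred1_eq; congr (_ + _).
rewrite cut_gen !linear_sum exchange_big; apply: eq_bigr => w wP /=.
rewrite root_action_gen attach_gen; apply: eq_bigr => u _; congr (gen R _).
have wr : w != r by apply: contraNneq rP => <-.
apply: graphP => //= [v|].
  rewrite !ffunE tpermV tpermR liftK -/r.
  by case: (eqVneq v w) => [->|//]; rewrite (negPf wr).
apply: eq_extend_last => [|i]; rewrite 3!ffunE tpermV.
  by rewrite tpermL extend_last_max unlift_none.
by rewrite swap_last_lift !extend_last_lift liftK ffunE.
Qed.

(** The edge from w to c is replaced by an edge from w to an arbitrary node u; the
    forest comes back when u is c. *)
Lemma attach_cut_gen m n p (g : graph 'I_m.+1 n p.+1) :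
  is_forest g ->
  let c := cov g ord_max in
  attach (cut (gen R g)) = #|predecessors g c|%:R *: gen R g +
    \sum_(w in predecessors g c) \sum_(u | u != c)
      gen R (attach_last_root u (cut_edge w g)).
Proof.
move=> gf c; rewrite cut_gen linear_sum /= -/c scaler_nat -sumr_const -big_split.
apply: eq_bigr => w wP; rewrite attach_gen (bigD1 c) //=; congr (_ + _).
congr (gen R _); apply: graphP => //= [v|i].
  by rewrite !ffunE unlift_none; case: eqP => // ->; apply/esym/eqP.
by rewrite !ffunE liftK.
Qed.

Lemma redirect_predecessors (V : finType) n p (g : graph V n p) c w u :
  w \in predecessors g c -> u != c ->
  #|predecessors (attach_last_root u (cut_edge w g)) c|.+1 = #|predecessors g c|.
Proof.
move=> wP uc; rewrite [RHS](cardD1 w) wP add1n; congr _.+1; apply: eq_card => v.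
rewrite !inE /= !ffunE unlift_none.
by case: (eqVneq v w) => [_|//]; rewrite !eqE /= (negPf uc).
Qed.

Notation attach_cut := (@attach R _ _ \o @cut R _ _).

(** [attach \o cut] multiplies a forest by the number of predecessors of the last
    covertex, up to forests where this number is smaller by one. *)
Lemma peel_gen M m n p (g : graph 'I_m.+1 n p.+1) :
  is_forest g -> (#|predecessors g (cov g ord_max)| < M)%N ->
  peel attach_cut M (gen R g) = 0.
Proof.
elim: M m g => // M IHM m g gf; set c := cov g ord_max => lt_k_M /=.
rewrite attach_cut_gen // -/c addrAC -scalerBl linearD linearZ linear_sum /=.
rewrite big1 ?addr0 => [|w wP]; last first.
  rewrite linear_sum big1 // => u uc /=; apply: IHM.
    apply/attach_last_root_forest/cut_edge_forest => //.
    by move: wP; rewrite inE /= => /eqP ->.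
  by rewrite -(redirect_predecessors wP uc) in lt_k_M.
move: lt_k_M; rewrite ltnS leq_eqVlt => /orP[/eqP ->|lt_k_M].
  by rewrite subrr scale0r.
by rewrite IHM // scaler0.
Qed.

Lemma peel_span n p (x : lincomb R n p.+1) :
  span_forests R n p.+1 x -> exists M, peel attach_cut M x = 0.
Proof.
move=> xs; suff [M MP] : exists M, forall M', (M <= M')%N -> peel attach_cut M' x = 0.
  by exists M; apply: MP.
elim/span_ind: x / xs => [|a x y [M MP] [N NP]|m g gf].
- by exists 0%N => M _; rewrite linear0.
- exists (maxn M N) => M'; rewrite geq_max => /andP[/MP xM /NP yN].
  by rewrite linearP /= xM yN scaler0 addr0.
- by exists #|predecessors g (cov g ord_max)|.+1 => M'; apply: peel_gen.
Qed.

(** On the kernel of [attach], [cut_attach] says that attaching the next to last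
    root of [cut x] gives [- x]; this is the second term of [alternate_step]. *)
Lemma attach_alt_cut n p (x : lincomb R n.+1 p.+1) :
  span_forests R n.+1 p.+1 x -> root_alternating x -> attach x = 0 ->
  n.+2%:R *: attach (alt_roots (cut x)) = attach (cut x) + n.+1%:R *: x.
Proof.
move=> xs xr x0.
have step := alternate_step (F := @attach R n.+1 p.+1) (y := cut x)
  (root_action_is_action R n.+2 p.+1) (root_action_is_action R n.+1 p.+1).
have cutA s : root_action (lift_last s) (cut x) = (-1) ^+ s *: cut x.
  by rewrite -cut_root_action xr linearZ.
rewrite step //=; last by move=> s y; apply: attach_root_action.
have /eqP := cut_attach xs; rewrite x0 linear0 eq_sym addrC addr_eq0 => /eqP ->.
rewrite subZ_linearN /= (alternate_id xr) alternate_id; first by [].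
move=> s /=.
by rewrite -attach_root_action cutA linearZ.
Qed.

Lemma attach_attach_cut n p (x : lincomb R n.+1 p.+1) :
  span_forests R n.+1 p.+1 x -> attach x = 0 -> attach (attach (cut x)) = 0.
Proof.
move=> xs x0; rewrite -attach_attach; last exact: span_cut.
have /eqP := cut_attach xs; rewrite x0 linear0 eq_sym addrC addr_eq0 => /eqP ->.
by rewrite linearN /= x0 oppr0.
Qed.

(** If N - M maps x to a boundary [attach y], then [attach_alt_cut] shows that
    (M + n) x is a boundary too, n being the number of roots.  As M + n is not
    zero, the factors N - M that annihilate x can be removed one at a time. *)
Lemma attach_exact_roots n p (x : lincomb R n.+1 p.+1) :
  span_forests R n.+1 p.+1 x -> root_alternating x -> attach x = 0 ->
  exists y, [/\ span_forests R n.+2 p.+1 y, root_alternating y & attach y = x].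
Proof.
move=> xs; have [M] := peel_span xs; elim: M x xs => [|M IHM] x xs /= xM xr x0.
  by exists 0; split=> [|s|]; rewrite ?linear0 ?scaler0 ?xM //; exact: span0.
have [|||y [ys yr yE]] := IHM _ _ xM.
- by apply/spanB/spanZ => //; apply/span_attach/span_cut.
- move=> s /=; rewrite linearB linearZ /= xr -attach_root_action.
  rewrite -cut_root_action xr 2!linearZ /= scalerBr.
  by rewrite !scalerA (mulrC M%:R).
- by rewrite linearB linearZ /= x0 scaler0 subr0 attach_attach_cut.
have Mn0 : M%:R + n.+1%:R != 0 :> R by rewrite -natrD addnS pnatr_eq0.
exists ((M%:R + n.+1%:R)^-1 *: (n.+2%:R *: alt_roots (cut x) - y)); split.
- by apply/spanZ/spanB => //; apply/spanZ/span_alt_roots/span_cut.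
- move=> s /=; rewrite linearZ linearB linearZ /= yr.
  rewrite (alternating_alternate (root_action_is_action R n.+2 p.+1)).
  exact: scale_out.
rewrite linearZ linearB linearZ /= attach_alt_cut // yE opprB [_ + n.+1%:R *: x]addrC.
by rewrite addrACA subrr addr0 -scalerDl [n.+1%:R + _]addrC scalerA mulVf // scale1r.
Qed.

Lemma attach_alt_covs n p (x : lincomb R n.+1 p) :
  attach (alt_covs x) = alt_covs (attach x).
Proof. by apply: alternate_equivariant => t y; apply: attach_cov_action. Qed.

Lemma dH_exact_positive n p (x : lincomb R n.+1 p.+1) :
  Omega R n.+1 p.+1 x -> dH x = 0 -> exists2 y, Omega R n.+2 p.+1 y & dH y = x.
Proof.
move=> /OmegaP[xs xr xc]; rewrite dHE => /(attach_exact_roots xs xr)[y [ys yr yE]].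
exists (alt_covs y); last by rewrite dHE attach_alt_covs yE (alternate_id xc).
apply/OmegaP; split.
- exact: span_alt_covs.
- rewrite -(alternate_id yr) -alt_rootsC.
  exact/alternating_alternate/root_action_is_action.
- exact/alternating_alternate/cov_action_is_action.
Qed.

(** The argument runs through [dV] and comes back by its left inverse [hV]. *)
Lemma dH_exact_zero n (x : lincomb R n.+1 0) :
  Omega R n.+1 0 x -> dH x = 0 -> exists2 y, Omega R n.+2 0 y & dH y = x.
Proof.
move=> xO x0.
have [|y yO yE] := dH_exact_positive (Omega_dV xO).
  by rewrite dH_dV // x0 dVE wedgeE !linear0.
exists (hV y); first exact: Omega_hV.
by rewrite dH_hV yE hV_dV.
Qed.

End Horizontal.

(** * Multilinear sums of graphs *)

HB.lock Definition add_q (R : realType) n p (q : nat) (x : lincomb R n p) :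
  lincomb R n p := Dq q x.
HB.lock Definition forget_mark (R : realType) n p (x : lincomb R n p) :
  lincomb R n p := unmark_lin x.
HB.lock Definition number (R : realType) n p (x : lincomb R n p) :
  lincomb R n.+1 p := number_detached x.

Definition with_succ (V : finType) n p (g : graph V n p)
    (s : {ffun V -> option V}) : graph V n p :=
  Graph s (root g) (cov g) (mark g).

(** The tensor product of the weights W w on the outgoing edges of the nodes w,
    [None] standing for the absence of an edge: operators that act edge by edge
    become operations on the weights. *)
HB.lock Definition multi (R : realType) m n p (g : graph 'I_m.+1 n p)
    (W : 'I_m.+1 -> option 'I_m.+1 -> R) : lincomb R n p :=
  \sum_(s : {ffun 'I_m.+1 -> option 'I_m.+1})
    (\prod_w W w (s w)) *: gen R (with_succ g s).

Lemma eq_scale (K : pzRingType) (M : lmodType K) (a b : K) (x y : M) :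
  a = b -> x = y -> a *: x = b *: y.
Proof. by move=> -> ->. Qed.

Section Multi.
Variable R : realType.
Implicit Types n p : nat.

Lemma with_succ_id (V : finType) n p (g : graph V n p) : with_succ g (succ g) = g.
Proof. by case: g. Qed.

Lemma eq_multi m n p (g h : graph 'I_m.+1 n p) (W W' : _ -> _ -> R) :
  root g = root h -> cov g = cov h -> mark g = mark h -> W =2 W' ->
  multi g W = multi h W'.
Proof.
move=> er ec em eW; rewrite multi.unlock /with_succ er ec em.
by apply: eq_bigr => s _; apply: eq_scale => //; apply: eq_bigr.
Qed.

Lemma multi_relabel m n p a (g : graph 'I_m.+1 n p) (W : _ -> _ -> R) :
  multi (relabel a g) W = multi g (fun w b => W (a w) (omap a b)).
Proof.
rewrite multi.unlock.
pose rl (s : {ffun 'I_m.+1 -> option 'I_m.+1}) :=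
  [ffun v => omap a (s ((a^-1)%g v))] : {ffun 'I_m.+1 -> option 'I_m.+1}.
rewrite [LHS](reindex rl); last first.
  exists (fun s : {ffun 'I_m.+1 -> option 'I_m.+1} =>
      [ffun v => omap (a^-1)%g (s (a v))]) => s _; apply/ffunP => v.
    by rewrite !ffunE permK; case: (s v) => //= u; rewrite permK.
  by rewrite !ffunE permKV; case: (s v) => //= u; rewrite permKV.
apply: eq_bigr => s _; apply: eq_scale; last exact: (gen_relabel R a (with_succ g s)).
rewrite (reindex_inj (@perm_inj _ a)) /=.
by apply: eq_bigr => w _; rewrite ffunE permK.
Qed.

Lemma multi_succ m n p (g : graph 'I_m.+1 n p) :
  multi g (fun w a => (a == succ g w)%:R : R) = gen R g.
Proof.
rewrite multi.unlock (bigD1 (succ g)) //= big1 => [|w _]; last by rewrite eqxx.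
rewrite scale1r with_succ_id big1 ?addr0 // => s sg.
have [w sw] : exists w, s w != succ g w.
  by apply/existsP; apply: contraNT sg => /existsPn sE; apply/eqP/ffunP => w;
    apply/eqP; have := sE w; rewrite negbK.
by rewrite (bigD1 w) //= (negPf sw) mul0r scale0r.
Qed.

Lemma linear_multi m n p (M : lmodType R) (F : {linear lincomb R n p -> M})
    (g : graph 'I_m.+1 n p) (W : _ -> _ -> R) :
  F (multi g W) =
  \sum_(s : {ffun 'I_m.+1 -> option 'I_m.+1})
    (\prod_w W w (s w)) *: F (gen R (with_succ g s)).
Proof.
by rewrite multi.unlock linear_sum; apply: eq_bigr => s _; rewrite linearZ.
Qed.

Lemma eq_on_support m (M : lmodType R) (W : _ -> _ -> R)
    (F G : {ffun 'I_m.+1 -> option 'I_m.+1} -> M) :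
  (forall s : {ffun 'I_m.+1 -> option 'I_m.+1},
     (forall w, W w (s w) != 0) -> F s = G s) ->
  \sum_(s : {ffun 'I_m.+1 -> option 'I_m.+1}) (\prod_w W w (s w)) *: F s =
  \sum_(s : {ffun 'I_m.+1 -> option 'I_m.+1}) (\prod_w W w (s w)) *: G s.
Proof.
move=> FG; apply: eq_bigr => s _.
have [sW|] := boolP [forall w, W w (s w) != 0].
  by rewrite FG // => w; apply/forallP: w.
by move=> /forallPn[w /negPn/eqP w0]; rewrite (bigD1 w) //= w0 mul0r !scale0r.
Qed.

(** Composition of linear maps acting in each slot: the product over the nodes and
    the sum over the intermediate successor maps are exchanged by distributivity. *)
Lemma multi_comp m n p (g : graph 'I_m.+1 n p) (W : _ -> _ -> R)
    (T : 'I_m.+1 -> option 'I_m.+1 -> option 'I_m.+1 -> R) :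
  \sum_(s : {ffun 'I_m.+1 -> option 'I_m.+1})
    (\prod_w W w (s w)) *: multi g (fun w => T w (s w)) =
  multi g (fun w a => \sum_b W w b * T w b a).
Proof.
rewrite multi.unlock.
rewrite [LHS](eq_bigr _ (fun s _ => scaler_sumr _ _ _ _)).
rewrite exchange_big /=; apply: eq_bigr => t _.
rewrite bigA_distr_bigA /= scaler_suml; apply: eq_bigr => s _.
by rewrite scalerA -big_split.
Qed.

Lemma multi_slot_sum m n p (I : finType) (g : graph 'I_m.+1 n p) r
    (T : I -> option 'I_m.+1 -> R) (W : _ -> _ -> R) :
  \sum_i multi g (fun w a => if w == r then T i a else W w a) =
  multi g (fun w a => if w == r then \sum_i T i a else W w a).
Proof.
rewrite multi.unlock exchange_big /=; apply: eq_bigr => s _.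
rewrite -scaler_suml; apply: eq_scale => //.
rewrite [RHS](bigD1 r) //= eqxx mulr_suml; apply: eq_bigr => i _.
rewrite (bigD1 r) //= eqxx; congr (_ * _).
by apply: eq_bigr => w /negPf ->.
Qed.

Lemma multi_slot0 m n p (g : graph 'I_m.+1 n p) (W : _ -> _ -> R) r :
  (forall a, W r a = 0) -> multi g W = 0.
Proof.
move=> W0; rewrite multi.unlock big1 // => s _.
by rewrite (bigD1 r) //= W0 mul0r scale0r.
Qed.

Lemma multi_add m n p (g : graph 'I_m.+1 n p) (A B : _ -> _ -> R) :
  multi g (fun w a => A w a + B w a) =
  \sum_(J : {set 'I_m.+1}) multi g (fun w a => if w \in J then A w a else B w a).
Proof.
rewrite multi.unlock exchange_big /=; apply: eq_bigr => s _.
by rewrite -scaler_suml bigA_distr.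
Qed.

Lemma span_multi m n p (g : graph 'I_m.+1 n p) (W : _ -> _ -> R) :
  (forall s : {ffun 'I_m.+1 -> option 'I_m.+1},
     (forall w, W w (s w) != 0) -> is_forest (with_succ g s)) ->
  span_forests R n p (multi g W).
Proof.
move=> Wf; rewrite multi.unlock; apply: span_sum => s _.
have [sW|] := boolP [forall w, W w (s w) != 0].
  by apply/spanZ/span_gen/Wf => w; apply/forallP: w.
move=> /forallPn[w /negPn/eqP w0]; rewrite (bigD1 w) //= w0 mul0r scale0r.
exact: span0.
Qed.

End Multi.

(** * Reattaching detached nodes *)

Section Detach.
Variable R : realType.
Implicit Types n p : nat.

Definition fill (T : finType) (Q : pred (option T)) (J : {set T})
    (s : {ffun T -> option T}) (w : T) (a : option T) : R :=
  if w \in J then (Q a)%:R else (a == s w)%:R.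

Lemma add_q_is_linear q n p : linear (@add_q R n p q).
Proof. by move=> a x y; rewrite add_q.unlock; exact: linext_is_linear. Qed.
HB.instance Definition _ q n p :=
  GRing.isLinear.Build R (lincomb R n p) (lincomb R n p) _ _
    (@add_q_is_linear q n p).

Lemma forget_mark_is_linear n p : linear (@forget_mark R n p).
Proof. by move=> a x y; rewrite forget_mark.unlock; exact: linext_is_linear. Qed.
HB.instance Definition _ n p :=
  GRing.isLinear.Build R (lincomb R n p) (lincomb R n p) _ _
    (@forget_mark_is_linear n p).

Lemma number_is_linear n p : linear (@number R n p).
Proof. by move=> a x y; rewrite number.unlock; exact: linext_is_linear. Qed.
HB.instance Definition _ n p :=
  GRing.isLinear.Build R (lincomb R n p) (lincomb R n.+1 p) _ _
    (@number_is_linear n p).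

Lemma prod_nat_bool (I : finType) (P : pred I) :
  \prod_i (P i)%:R = [forall i, P i]%:R :> R.
Proof.
case: forallP => [PT|PF]; first by rewrite big1 // => i _; rewrite PT.
have [i /negPf Pi] : exists i, ~~ P i.
  by apply/existsP; rewrite -negb_forall; apply/negP => /forallP.
by rewrite (bigD1 i) //= Pi mul0r.
Qed.

Lemma not_marked_relabel (V : finType) n p (a : {perm V}) (g : graph V n p) b :
  not_marked (relabel a g) (omap a b) = not_marked g b.
Proof.
by congr (~~ _ && ~~ _); [exact: (omap_perm_eq a b None)|exact: omap_perm_eq].
Qed.

(** The partial maps from J to the unmarked nodes correspond to the successor maps
    that extend the given one, so their sum is a tensor. *)
Lemma DJ_multi m n p (J : {set 'I_m.+1}) (g : graph 'I_m.+1 n p) :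
  DJ R J g = multi g (fill (not_marked g) J (succ g)).
Proof.
pose T := {ffun 'I_m.+1 -> option 'I_m.+1}.
pose P (s : T) w := if w \in J then not_marked g (s w) else s w == succ g w.
rewrite multi.unlock (eq_bigr (fun s : T =>
  if [forall w, P s w] then gen R (with_succ g s) else 0)) => [|s _]; last first.
  rewrite (eq_bigr (fun w => (P s w)%:R)) => [|w _].
    by rewrite prod_nat_bool; case: ifP => _; rewrite ?scale1r ?scale0r.
  by rewrite /fill /P; case: ifP.
rewrite -big_mkcond /=.
pose h (phi : T) : T := succ (add_edges phi g).
pose h' (s : T) : T := [ffun w => if w \in J then s w else None].
rewrite (reindex_onto h h') => [|s /forallP sP] /=; last first.
  apply/ffunP => w; rewrite !ffunE; have := sP w; rewrite /P.
  by case: ifP => _; [case: (s w)|move/eqP].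
rewrite gen.unlock; apply: eq_big => [phi|//].
have PE := @pfamilyP _ _ (predPredType _) None J (fun=> not_marked g) phi.
apply/PE/andP => [[/supportP sJ im]|[/forallP hP /eqP hK]].
  split.
    apply/forallP => w; rewrite /P ffunE; case: ifP => wJ; last by rewrite sJ ?wJ.
    by have := im w wJ; case: (phi w).
  apply/eqP/ffunP => w; rewrite !ffunE; case: ifP => wJ; last by rewrite sJ ?wJ.
  by have := im w wJ; case: (phi w).
split=> [|w wJ].
  by apply/supportP => w wJ; rewrite -hK ffunE (negPf wJ).
by have := hP w; rewrite /P wJ -{2}hK [h' _ _]ffunE wJ.
Qed.

Lemma number_gen m n p (g : graph 'I_m.+1 n p) :
  number (gen R g) =
  if #|detached g| == 1%N then \sum_(w | detached g w) gen R (number_root w g) else 0.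
Proof.
rewrite gen.unlock number.unlock; apply: linext_basis => k a h.
rewrite (_ : #|detached (relabel a h)| = #|detached h|); last first.
  rewrite -[RHS](card_imset _ (@perm_inj _ a)); apply: eq_card => v.
  rewrite -(permKV a v) (mem_imset _ _ (@perm_inj _ a)).
  exact: detached_relabel.
case: ifP => [_|//]; rewrite [LHS](reindex_inj (@perm_inj _ a)) /=; apply: eq_big => w.
  exact: detached_relabel.
by move=> _; rewrite number_root_relabel basis_relabel.
Qed.

Lemma forget_mark_gen m n p (g : graph 'I_m.+1 n p) :
  forget_mark (gen R g) = gen R (unmark g).
Proof.
rewrite gen.unlock forget_mark.unlock; apply: linext_basis => k a h.
by rewrite unmark_relabel basis_relabel.
Qed.

Lemma add_q_gen q m n p (g : graph 'I_m.+1 n p) :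
  add_q q (gen R g) =
  \sum_(J : {set 'I_m.+1} | (J \subset detached g) && (#|J| == q))
     multi g (fill (not_marked g) J (succ g)).
Proof.
rewrite -(eq_bigr _ (fun J _ => DJ_multi J g)).
rewrite gen.unlock add_q.unlock; apply: linext_basis => k a h.
have aI := imset_inj (@perm_inj _ a).
rewrite [LHS](reindex_inj aI) /=; apply: eq_big => J.
  rewrite card_imset; last exact: perm_inj.
  congr (_ && _); apply/idP/idP => /fintype.subsetP sub; apply/fintype.subsetP => v.
    move=> vJ; rewrite -[_ \in _](detached_relabel a).
    by apply: sub; apply: imset_f.
  by case/imsetP => w wJ ->; apply: etrans (detached_relabel a h w) (sub w wJ).
move=> _; rewrite !DJ_multi multi_relabel; apply: eq_multi => //= w b.
rewrite /fill (mem_imset _ _ (@perm_inj _ a)) ffunE permK.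
by rewrite omap_perm_eq not_marked_relabel.
Qed.

Lemma eulerE m n p q v (g : graph 'I_m.+1 n p) :
  euler R q v g =
  let k := #|predecessors g v| in
  if (q <= k)%N then
    (-1) ^+ (k - q) *: forget_mark (add_q (k - q) (gen R (detach v g)))
  else 0.
Proof. by rewrite forget_mark.unlock add_q.unlock gen.unlock. Qed.

Lemma card_predecessors_relabel (V : finType) n p (a : {perm V}) (g : graph V n p) v :
  #|predecessors (relabel a g) (a v)| = #|predecessors g v|.
Proof.
rewrite -[RHS](card_imset _ (@perm_inj _ a)); apply: eq_card => w.
rewrite -(permKV a w) (mem_imset _ _ (@perm_inj _ a)).
exact: predecessors_relabel.
Qed.

Lemma euler_relabel m n p q v (a : 'S_m.+1) (g : graph 'I_m.+1 n p) :
  euler R q (a v) (relabel a g) = euler R q v g.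
Proof.
by rewrite !eulerE card_predecessors_relabel detach_relabel gen_relabel.
Qed.

End Detach.

(** * Euler operators *)

(** The map I before alternation. *)
HB.lock Definition euler0 (R : realType) p (x : lincomb R 0 p.+1) :
  lincomb R 0 p.+1 := linext (fun m g => euler R 0 (cov g ord_max) g) x.

(** The augmented homotopy before alternation. *)
HB.lock Definition aug0 (R : realType) p (x : lincomb R 0 p.+1) :
  lincomb R 1 p.+1 :=
  linext (fun m g =>
    let c := cov g ord_max in
    \sum_(1 <= q < #|predecessors g c|.+1)
      q%:R^-1 *: number_detached (Dq q.-1 (euler R q c g))) x.

Section Euler.
Variable R : realType.
Implicit Types n p : nat.

Lemma euler0_is_linear p : linear (@euler0 R p).
Proof. by move=> a x y; rewrite euler0.unlock; exact: linext_is_linear. Qed.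
HB.instance Definition _ p :=
  GRing.isLinear.Build R (lincomb R 0 p.+1) (lincomb R 0 p.+1) _ _
    (@euler0_is_linear p).

Lemma aug0_is_linear p : linear (@aug0 R p).
Proof. by move=> a x y; rewrite aug0.unlock; exact: linext_is_linear. Qed.
HB.instance Definition _ p :=
  GRing.isLinear.Build R (lincomb R 0 p.+1) (lincomb R 1 p.+1) _ _
    (@aug0_is_linear p).

Lemma euler0_gen m p (g : graph 'I_m.+1 0 p.+1) :
  euler0 (gen R g) = euler R 0 (cov g ord_max) g.
Proof.
rewrite gen.unlock euler0.unlock.
apply: (linext_basis (f := fun m g => euler R 0 (cov g ord_max) g)) => k a h.
by rewrite [cov _ _]ffunE euler_relabel.
Qed.

Lemma aug0_gen m p (g : graph 'I_m.+1 0 p.+1) :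
  let c := cov g ord_max in
  aug0 (gen R g) = \sum_(1 <= q < #|predecessors g c|.+1)
    q%:R^-1 *: number (add_q q.-1 (euler R q c g)).
Proof.
rewrite gen.unlock aug0.unlock number.unlock add_q.unlock /=.
apply: linext_basis => k a h.
rewrite [cov (relabel _ _) _]ffunE card_predecessors_relabel.
by apply: eq_bigr => q _; rewrite euler_relabel.
Qed.

Lemma sum_deltal (I : finType) (x : I) (f : I -> R) :
  \sum_b (b == x)%:R * f b = f x.
Proof.
rewrite (bigD1 x) //= eqxx mul1r big1 ?addr0 // => b /negPf ->.
by rewrite mul0r.
Qed.

Lemma sum_deltar (I : finType) (x : I) (f : I -> R) :
  \sum_b f b * (x == b)%:R = f x.
Proof.
rewrite (bigD1 x) //= eqxx mulr1 big1 ?addr0 // => b.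
by rewrite eq_sym => /negPf ->; rewrite mulr0.
Qed.

Lemma multi_sign m n p (J : {set 'I_m.+1}) (g : graph 'I_m.+1 n p) (W : _ -> _ -> R) :
  (-1) ^+ #|J| *: multi g W =
  multi g (fun w a => if w \in J then - W w a else W w a).
Proof.
rewrite multi.unlock scaler_sumr; apply: eq_bigr => s _; rewrite scalerA.
apply: eq_scale => //; rewrite -prodr_const big_mkcond -big_split /=.
by apply: eq_bigr => w _; case: ifP => _; rewrite ?mulN1r ?mul1r.
Qed.

Definition elsewhere (T : finType) (v : T) (a : option T) : bool :=
  (a != None) && (a != Some v).

(** Weight of the graphs of the Euler operator in which J is the set of nodes that
    have been reattached away from v: the other predecessors of v are detached, and
    each reattached node contributes a sign. *)
Definition euler_slot m n p (v : 'I_m.+1) (g : graph 'I_m.+1 n p)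
    (J : {set 'I_m.+1}) w a : R :=
  if w \in J then - (elsewhere v a)%:R else
  if w \in predecessors g v then (a == None)%:R else (a == succ g w)%:R.

Lemma detached_detach (V : finType) n p (g : graph V n p) v :
  is_forest g -> detached (detach v g) =i predecessors g v.
Proof.
move=> /is_forestP[_ _ sr _] w.
rewrite -[LHS]/(_ && _) -[w \in codom _]/(w \in codom (root g)) -sr ffunE.
rewrite inE /=; case: (succ g w) => [u|] //=.
by rewrite andbT; case: (_ == Some v).
Qed.

Lemma forget_mark_multi m n p (g : graph 'I_m.+1 n p) (W : _ -> _ -> R) :
  forget_mark (multi g W) = multi (unmark g) W.
Proof.
rewrite linear_multi multi.unlock; apply: eq_bigr => s _.
by rewrite /= forget_mark_gen.
Qed.

Lemma euler_multi m n p q v (g : graph 'I_m.+1 n p) :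
  is_forest g -> (q <= #|predecessors g v|)%N ->
  euler R q v g =
  \sum_(J : {set 'I_m.+1} |
     (J \subset predecessors g v) && (#|J| == #|predecessors g v| - q)%N)
    multi g (euler_slot v g J).
Proof.
move=> gf qk; have [_ _ _ mg] := is_forestP _ gf.
rewrite eulerE /= qk add_q_gen linear_sum scaler_sumr /=.
apply: eq_big => [J|J /andP[_ /eqP <-]].
  by rewrite (eq_subset_r (detached_detach v gf)).
rewrite forget_mark_multi multi_sign; apply: eq_multi => //= w a.
rewrite /euler_slot /fill; case: (w \in J) => //=.
by rewrite ffunE; case: ifP.
Qed.

(** Integration by parts in one slot: an edge to v becomes minus the sum of the
    edges to the other nodes. *)
Definition parts_slot (T : finType) (v : T) (b a : option T) : R :=
  if b == Some v then - (elsewhere v a)%:R else (a == b)%:R.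

Lemma euler_order0 m n p v (g : graph 'I_m.+1 n p) :
  is_forest g ->
  euler R 0 v g = multi g (fun w => parts_slot v (succ g w)).
Proof.
move=> gf; rewrite euler_multi // subn0.
pose J0 := [set w in predecessors g v].
have J0E : J0 =i predecessors g v by move=> w; rewrite inE.
rewrite (big_pred1 J0) => [|J]; last first.
  rewrite -(eq_subset_r J0E) -(eq_card J0E) [RHS]/= eqEcard.
  have [sJ|//] := boolP (J \subset J0); rewrite /= eqn_leq.
  by rewrite (subset_leq_card sJ).
apply: eq_multi => // w a; rewrite /euler_slot /parts_slot J0E.
by rewrite -[w \in _]/(succ g w == Some v); case: (_ == _).
Qed.

Lemma sum_parts_slot (T : finType) (v : T) a :
  \sum_u parts_slot v (Some u) a = 0.
Proof.
rewrite (bigD1 v) //= {1}/parts_slot eqxx.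
rewrite (eq_bigr (fun u => (a == Some u)%:R)) => [|u uv]; last first.
  by rewrite /parts_slot (inj_eq (@Some_inj _)) (negPf uv).
case: a => [w|]; last by rewrite /elsewhere /= oppr0 add0r big1.
rewrite /elsewhere /= (inj_eq (@Some_inj _)).
have [->|wv] := eqVneq w v.
  rewrite oppr0 add0r big1 // => u uv.
  by rewrite (inj_eq (@Some_inj _)) eq_sym (negPf uv).
rewrite (bigD1 w) //= eqxx big1 ?addr0 ?addNr // => u /andP[_ uw].
by rewrite (inj_eq (@Some_inj _)) eq_sym (negPf uw).
Qed.

(** The node that was the root carries the sum of all edges, which is annihilated
    by [parts_slot]. *)
Lemma euler0_attach p (x : lincomb R 1 p.+1) :
  span_forests R 1 p.+1 x -> euler0 (attach x) = 0.
Proof.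
move=> xs; elim/span_ind: x / xs => [|a x y IHx IHy|m g gf].
- by rewrite !linear0.
- by rewrite !linearP /= IHx IHy scaler0 addr0.
set c := cov g ord_max; set r := root g ord_max.
pose W u w a := if w == r then parts_slot c (Some u) a
                else parts_slot c (succ g w) a.
rewrite attach_gen linear_sum /=.
rewrite (eq_bigr (fun u => multi (attach_last_root c g) (W u))) => [|u _].
  rewrite /W multi_slot_sum; apply: (@multi_slot0 _ _ _ _ _ _ r) => a.
  by rewrite eqxx sum_parts_slot.
rewrite euler0_gen euler_order0; last exact: attach_last_root_forest.
by apply: eq_multi => // w a; rewrite /W ffunE -/r; case: ifP.
Qed.

Lemma span_euler0 p (x : lincomb R 0 p.+1) :
  span_forests R 0 p.+1 x -> span_forests R 0 p.+1 (euler0 x).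
Proof.
apply: linear_span => m g gf /=; rewrite euler0_gen euler_order0 //.
have [ri ci sr mg] := is_forestP _ gf.
apply: span_multi => s sW; apply/is_forestP; split=> //= w.
have nr (h : {ffun 'I_0 -> 'I_m.+1}) : w \notin codom h by apply/codomP => -[[]].
rewrite (negPf (nr _)); have := sr w; rewrite (negPf (nr _)) => sw.
have := sW w; rewrite /parts_slot /elsewhere; case: ifP => _.
  by case: (s w) => //=; rewrite oppr0 => /eqP.
by case: (s w =P _) => [->|_] /=; rewrite ?sw // => /eqP.
Qed.

Definition free_slot (T : finType) (D : pred T) (w : T) (b a : option T) : R :=
  if w \in D then (a != None)%:R else (a == b)%:R.

Lemma attach_number m p (h : graph 'I_m.+1 0 p) :
  #|detached h| = 1%N ->
  attach (number (gen R h)) =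
  multi h (fun w => free_slot (detached h) w (succ h w)).
Proof.
move=> d1; have [w0 dE] := mem_card1 d1.
rewrite number_gen d1 eqxx (big_pred1 w0) => [|w]; last exact: dE.
rewrite attach_gen.
pose W u w a : R := if w == w0 then (a == Some u)%:R else (a == succ h w)%:R.
rewrite (eq_bigr (fun u => multi h (W u))) => [|u _].
  rewrite /W multi_slot_sum; apply: eq_multi => // w a.
  rewrite /free_slot [w \in _]dE inE; case: eqP => // _.
  case: a => [v|] /=; last by rewrite big1.
  rewrite (bigD1 v) //= eqxx big1 ?addr0 // => u uv.
  by rewrite (inj_eq (@Some_inj _)) eq_sym (negPf uv).
rewrite -multi_succ; apply: eq_multi => //= [|w a].
  by apply/ffunP => -[].
by rewrite /W /= !ffunE unlift_none; case: ifP.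
Qed.

Lemma card_predD_sub (T : finType) (D : pred T) (K : {set T}) :
  K \subset D -> #|[predD D & K]| = (#|D| - #|K|)%N.
Proof.
move=> /fintype.subsetP KD; rewrite -(cardID K D).
rewrite (_ : #|[predI D & K]| = #|K|) ?addKn //.
by apply: eq_card => w; rewrite inE /= andbC; case: (boolP (w \in K)) => // /KD.
Qed.

(** The graphs where all the q + 1 detached nodes are attached arise once for each
    choice of the node that is left to become the root. *)
Lemma attach_number_add_q q m p (h : graph 'I_m.+1 0 p) :
  mark h = None -> #|detached h| = q.+1 ->
  attach (number (add_q q (gen R h))) =
  q.+1%:R *: multi h (fun w => free_slot (detached h) w (succ h w)).
Proof.
move=> mh dq; set D := detached h.
have noroot (w : 'I_m.+1) (f : {ffun 'I_0 -> 'I_m.+1}) : w \notin codom f.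
  by apply/codomP => -[[]].
rewrite add_q_gen !linear_sum /=.
rewrite (eq_bigr (fun=> multi h (fun w => free_slot D w (succ h w)))).
  rewrite sumr_const -scaler_nat; apply: eq_scale => //; congr (_%:R).
  pose D' := [set w in D]; have D'E : D' =i D by move=> w; rewrite inE.
  rewrite -(binSn q) -dq -(eq_card D'E) -cards_draws; apply: eq_card => K.
  by rewrite inE (eq_subset_r D'E).
move=> K /andP[KD /eqP Kq].
have dK (s : {ffun 'I_m.+1 -> option 'I_m.+1}) :
    (forall w, fill R (not_marked h) K (succ h) w (s w) != 0) ->
    detached (with_succ h s) =i [predD D & K].
  move=> sW w; have := sW w; rewrite /fill !inE /= !noroot !andbT.
  case: (w \in K) => /=; first by case: (s w) => //= /eqP.
  by case: (s w =P succ h w) => [->|_] //= /eqP.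
apply: etrans (linear_multi (@attach R 0 p \o @number R 0 p) _ _) _.
rewrite (eq_on_support (G := fun s : {ffun 'I_m.+1 -> option 'I_m.+1} =>
  multi h (fun w => free_slot [predD D & K] w (s w)))) => [|s sW].
  rewrite multi_comp; apply: eq_multi => // w a; rewrite /free_slot /fill inE.
  case: (boolP (w \in K)) => [wK|wK] /=.
    rewrite (fintype.subsetP KD _ wK) sum_deltar /not_marked /= mh.
    by case: (a == None).
  by case: (w \in D); rewrite sum_deltal.
rewrite /= attach_number.
  by apply: eq_multi => // w a; rewrite /free_slot dK.
by rewrite (eq_card (dK _ sW)) card_predD_sub // dq Kq subSnn.
Qed.

Lemma attach_number_euler q m p v (g : graph 'I_m.+1 0 p) :
  is_forest g -> (0 < q <= #|predecessors g v|)%N ->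
  let P := predecessors g v in
  attach (number (add_q q.-1 (euler R q v g))) =
  q%:R *: \sum_(J : {set 'I_m.+1} | (J \subset P) && (#|J| == #|P| - q)%N)
    multi g (fun w a => if w \in J then - (elsewhere v a)%:R
                        else free_slot P w (succ g w) a).
Proof.
case: q => // q gf /= qk; set P := predecessors g v.
have [_ _ sr mg] := is_forestP _ gf.
have noroot (w : 'I_m.+1) (f : {ffun 'I_0 -> 'I_m.+1}) : w \in codom f = false.
  by apply/negP => /codomP -[[]].
rewrite euler_multi // !linear_sum /=.
apply: eq_bigr => J /andP[JP /eqP Jk].
apply: etrans (linear_multi
  (@attach R 0 p \o (@number R 0 p \o @add_q R 0 p q)) _ _) _.
have dJ (s : {ffun 'I_m.+1 -> option 'I_m.+1}) :
    (forall w, euler_slot v g J w (s w) != 0) ->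
    detached (with_succ g s) =i [predD P & J].
  move=> sW w; have := sW w; have := sr w.
  rewrite /euler_slot !inE /= !noroot !andbT => sw0.
  case: (w \in J) => /=; first by case: (s w) => //=; rewrite oppr0 => /eqP.
  case: (succ g w == Some v); first by case: (s w) => //= u /eqP.
  by case: (s w =P succ g w) => [->|_] //= /eqP.
rewrite (eq_on_support (G := fun s : {ffun 'I_m.+1 -> option 'I_m.+1} =>
  q.+1%:R *: multi g (fun w => free_slot [predD P & J] w (s w)))) => [|s sW].
  transitivity (q.+1%:R *: multi g (fun w a =>
      \sum_b euler_slot v g J w b * free_slot [predD P & J] w b a)).
    rewrite -multi_comp scaler_sumr; apply: eq_bigr => t _.
    by rewrite !scalerA mulrC.
  apply: eq_scale => //; apply: eq_multi => // w a.
  rewrite /free_slot /euler_slot [w \in [predD P & J]]inE.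
  case: (boolP (w \in J)) => [wJ|wJ] /=; first by rewrite sum_deltar.
  by case: (w \in P); rewrite sum_deltal.
rewrite /= attach_number_add_q.
- apply: eq_scale => //; apply: eq_multi => // w a; rewrite /free_slot dJ //.
- by rewrite /= mg.
- by rewrite (eq_card (dJ _ sW)) card_predD_sub // Jk subKn.
Qed.

End Euler.

(** * Rows without roots *)

Section AugmentedHomotopy.
Variable R : realType.
Implicit Types n p : nat.

Notation reattached g v J :=
  (fun w a => if w \in (J : {set _}) then - (elsewhere v a)%:R
              else free_slot R (predecessors g v) w (succ g w) a).

(** Expansion over the predecessors of v of: the edge to v is the sum of all edges
    minus the edges that avoid v. *)
Lemma sum_reattached m n p v (g : graph 'I_m.+1 n p) :
  gen R g = \sum_(J : {set 'I_m.+1} | J \subset predecessors g v)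
    multi g (reattached g v J).
Proof.
pose P := predecessors g v.
pose A w a : R := if w \in P then - (elsewhere v a)%:R else 0.
have := multi_add g A (fun w => free_slot R P w (succ g w)).
rewrite (bigID (fun J : {set 'I_m.+1} => J \subset P)) /= [X in _ + X]big1 ?addr0.
  move=> E; transitivity (multi g (fun w a => A w a + free_slot R P w (succ g w) a)).
    rewrite -multi_succ; apply: eq_multi => // w a; rewrite /A /free_slot.
    have [wP|wP] := boolP (w \in P); last by rewrite add0r.
    have /eqP -> : succ g w == Some v by exact: wP.
    rewrite /elsewhere; case: a => [u|] /=; last by rewrite oppr0 addr0.
    by rewrite (inj_eq (@Some_inj _)); case: eqP; rewrite ?oppr0 ?add0r ?addNr.
  rewrite E; apply: eq_bigr => J /fintype.subsetP JP; apply: eq_multi => // w a.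
  by case: ifP => // /JP wP; rewrite /A wP.
move=> J /fintype.subsetPn[w wJ wP]; apply: (@multi_slot0 _ _ _ _ _ _ w) => a.
by rewrite wJ /A (negPf wP).
Qed.

Lemma sum_by_card (T : finType) (M : nmodType) (P : pred T) (F : {set T} -> M) :
  \sum_(J : {set T} | J \subset P) F J =
  \sum_(0 <= q < #|P|.+1)
    \sum_(J : {set T} | (J \subset P) && (#|J| == #|P| - q)%N) F J.
Proof.
pose h (J : {set T}) : 'I_#|P|.+1 := inord (#|P| - #|J|).
rewrite (partition_big h xpredT) //= big_mkord; apply: eq_bigr => q _.
apply: eq_bigl => J; have [JP|//] := boolP (J \subset P); rewrite /= /h.
have JleP := subset_leq_card JP; have qleP : (q <= #|P|)%N by rewrite -ltnS.
rewrite -val_eqE /= inordK ?ltnS ?leq_subr //.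
by apply/eqP/eqP => [<-|->]; rewrite subKn.
Qed.

(** In [sum_reattached], the terms where no predecessor is left give [euler0], and
    those where q of them are left give the term of order q of [attach (aug0 x)],
    whose factor 1/q compensates the multiplicity in [attach_number_euler]. *)
Lemma euler0_homotopy p (x : lincomb R 0 p.+1) :
  span_forests R 0 p.+1 x -> euler0 x + attach (aug0 x) = x.
Proof.
apply: (eq_linear_span
  (F := @euler0 R p \+ (@attach R 0 p.+1 \o @aug0 R p)) (G := idfun)) => m g gf /=.
set c := cov g ord_max; pose P := predecessors g c.
rewrite [RHS](sum_reattached c) sum_by_card big_ltn //; congr (_ + _).
  rewrite euler0_gen euler_multi // -/c; apply: eq_bigr => J /andP[JP /eqP].
  rewrite subn0 => /subset_cardP/(_ JP) JE; apply: eq_multi => // w a.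
  by rewrite /euler_slot /free_slot -!JE; case: (w \in J).
rewrite aug0_gen linear_sum; apply: eq_big_nat => q /andP[q0 qk].
rewrite linearZ /= attach_number_euler ?q0 // scalerA mulVf ?scale1r //.
by rewrite pnatr_eq0 -lt0n.
Qed.

Lemma span_number m p (h : graph 'I_m.+1 0 p) :
  injective (cov h) -> mark h = None -> span_forests R 1 p (number (gen R h)).
Proof.
move=> ci mh; rewrite number_gen; case: eqP => [d1|_]; last exact: span0.
have [w0 dE] := mem_card1 d1.
have noroot w (f : {ffun 'I_0 -> 'I_m.+1}) : w \in codom f = false.
  by apply/negP => /codomP -[[]].
apply: span_sum => w; rewrite -[detached h w]/(w \in detached h) dE inE => /eqP ->.
apply/span_gen/is_forestP; split=> //=.
  by apply: inj_extend_last; [move=> []|rewrite noroot].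
move=> v; rewrite codom_extend_last noroot orbF -[v == w0]/(v \in pred1 w0) -dE.
by rewrite inE /= noroot andbT.
Qed.

Lemma span_aug0 p (x : lincomb R 0 p.+1) :
  span_forests R 0 p.+1 x -> span_forests R 1 p.+1 (aug0 x).
Proof.
apply: linear_span => m g gf /=; have [_ ci _ mg] := is_forestP _ gf.
rewrite aug0_gen big_nat; apply: span_sum => q /andP[q0 qk].
rewrite euler_multi //; apply: spanZ; rewrite !linear_sum; apply: span_sum => J _ /=.
rewrite -[number _]/((@number R 0 p.+1 \o @add_q R 0 p.+1 q.-1) _).
rewrite linear_multi; apply: span_sum => s _; apply: spanZ => /=.
rewrite add_q_gen linear_sum; apply: span_sum => K _ /=.
rewrite linear_multi; apply: span_sum => t _; apply: spanZ.
exact: span_number.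
Qed.

Lemma IopE p (x : lincomb R 0 p.+1) : Iop x = alt_covs (euler0 x).
Proof.
rewrite -[RHS]wedge_few_roots; last by [].
rewrite euler0.unlock; exact: erefl.
Qed.

Lemma aug_hHE p (x : lincomb R 0 p.+1) : aug_hH x = alt_covs (aug0 x).
Proof.
rewrite -[RHS]wedge_few_roots; last by [].
rewrite aug0.unlock; exact: erefl.
Qed.

Lemma Omega_Iop p (x : lincomb R 0 p.+1) :
  Omega R 0 p.+1 x -> Omega R 0 p.+1 (Iop x).
Proof.
move=> /Omega_span xs; rewrite IopE -wedge_few_roots //.
exact/Omega_wedge/span_euler0.
Qed.

Lemma Omega_aug_hH p (x : lincomb R 0 p.+1) :
  Omega R 0 p.+1 x -> Omega R 1 p.+1 (aug_hH x).
Proof.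
move=> /Omega_span xs; rewrite aug_hHE -wedge_few_roots //.
exact/Omega_wedge/span_aug0.
Qed.

Lemma Iop_dH p (x : lincomb R 1 p.+1) : Omega R 1 p.+1 x -> Iop (dH x) = 0.
Proof. by move=> /Omega_span xs; rewrite IopE dHE euler0_attach // linear0. Qed.

Lemma horizontal_homotopy p (x : lincomb R 0 p.+1) :
  Omega R 0 p.+1 x -> x = Iop x + dH (aug_hH x).
Proof.
move=> xO; have [xs _ xc] := (OmegaP _).1 xO.
rewrite IopE aug_hHE dHE attach_alt_covs -linearD /= euler0_homotopy //.
by rewrite (alternate_id xc).
Qed.

Lemma IopD p (x y : lincomb R 0 p.+1) : Iop (x + y) = Iop x + Iop y.
Proof. by rewrite !IopE !linearD. Qed.

Lemma IopB p (x y : lincomb R 0 p.+1) : Iop (x - y) = Iop x - Iop y.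
Proof. by rewrite !IopE !linearB. Qed.

Lemma Iop_Iop p (x : lincomb R 0 p.+1) : Omega R 0 p.+1 x -> Iop (Iop x) = Iop x.
Proof.
move=> xO; rewrite {2}(horizontal_homotopy xO) IopD Iop_dH ?addr0 //.
exact: Omega_aug_hH.
Qed.

End AugmentedHomotopy.

(** * The augmented bicomplex *)

Section Augmented.
Variable R : realType.
Implicit Types n p : nat.

Lemma calI_P p (x : lincomb R 0 p.+1) :
  calI R p x <-> Omega R 0 p.+1 x /\ Iop x = x.
Proof.
split=> [[y yO <-]|[xO xI]]; last by exists x.
by split; [exact: Omega_Iop|exact: Iop_Iop].
Qed.

Lemma calI_Iop p (x : lincomb R 0 p.+1) : Omega R 0 p.+1 x -> calI R p (Iop x).
Proof. by exists x. Qed.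

Lemma Iop_defect p (y : lincomb R 0 p.+1) :
  Omega R 0 p.+1 y -> exists2 z, Omega R 1 p.+1 z & Iop y = y - dH z.
Proof.
move=> yO; exists (aug_hH y); first exact: Omega_aug_hH.
by rewrite {2}(horizontal_homotopy yO) addrK.
Qed.

Lemma dV_sub n p (x y : lincomb R n p) : dV (x - y) = dV x - dV y.
Proof. by rewrite !dVE !wedgeE !linearB. Qed.

Lemma hV_sub n p (x y : lincomb R n p.+1) : hV (x - y) = hV x - hV y.
Proof. by rewrite !hVE linearB. Qed.

Lemma hV0 n p : hV 0 = 0 :> lincomb R n p.
Proof. by rewrite hVE linear0. Qed.

(** [Iop] changes y by a [dH z], and [Iop (dV (dH z))] is
    [Iop (dH (dV z))], which vanishes. *)
Lemma Iop_dV_Iop p (y : lincomb R 0 p.+1) :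
  Omega R 0 p.+1 y -> Iop (dV (Iop y)) = Iop (dV y).
Proof.
move=> yO; have [z zO ->] := Iop_defect yO.
rewrite dV_sub IopB -dH_dV // Iop_dH ?subr0 //; exact: Omega_dV.
Qed.

Lemma Iop_hV_Iop p (y : lincomb R 0 p.+2) :
  Omega R 0 p.+2 y -> Iop (hV (Iop y)) = Iop (hV y).
Proof.
move=> yO; have [z zO ->] := Iop_defect yO.
rewrite hV_sub IopB -dH_hV Iop_dH ?subr0 //; exact: Omega_hV.
Qed.

Lemma Iop0 p : Iop 0 = 0 :> lincomb R 0 p.+1.
Proof. by rewrite -[in LHS](subrr 0) IopB subrr. Qed.

Lemma deltaV_deltaV p (x : lincomb R 0 p) : Omega R 0 p x -> deltaV (deltaV x) = 0.
Proof.
by move=> xO; rewrite /deltaV Iop_dV_Iop ?dV_dV ?Iop0 //; exact: Omega_dV.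
Qed.

(** [Iop] applied to [vertical_homotopy]. *)
Lemma Iop_vertical p (x : lincomb R 0 p.+1) :
  calI R p x -> Iop (dV (hV x)) + aug_hV (deltaV x) = x.
Proof.
move=> /calI_P[xO xI]; rewrite /aug_hV /deltaV Iop_hV_Iop; last exact: Omega_dV.
by rewrite -IopD addrC vertical_homotopy.
Qed.

Lemma augmented_homotopy p (x : lincomb R 0 p.+2) :
  calI R p.+1 x -> x = deltaV (aug_hV x) + aug_hV (deltaV x).
Proof.
move=> xI; have [xO _] := (calI_P _).1 xI.
by rewrite /deltaV /aug_hV Iop_dV_Iop; [exact/esym/Iop_vertical|exact: Omega_hV].
Qed.

Lemma calI_deltaV p (x : lincomb R 0 p) : Omega R 0 p x -> calI R p (deltaV x).
Proof. by move=> xO; apply/calI_Iop/Omega_dV. Qed.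

Lemma calI_aug_hV p (x : lincomb R 0 p.+2) : calI R p.+1 x -> calI R p (aug_hV x).
Proof. by move=> /calI_P[xO _]; apply/calI_Iop/Omega_hV. Qed.

Lemma aug_hV0 p : aug_hV 0 = 0 :> lincomb R 0 p.+1.
Proof. by rewrite /aug_hV hV0 Iop0. Qed.

(** If [deltaV x] vanishes, [dV x] is a boundary [dH z]; then x is [hV (dV x)],
    that is [dH (hV z)]. *)
Lemma deltaV_exact_zero (x : lincomb R 0 0) :
  Omega R 0 0 x -> deltaV x = 0 -> exists2 y, Omega R 1 0 y & dH y = x.
Proof.
move=> xO x0; have [z zO zE] := Iop_defect (Omega_dV xO).
exists (hV z); first exact: Omega_hV.
have -> : x = hV (dV x) by rewrite hV_dV.
move/eqP: zE; rewrite -/(deltaV x) x0 eq_sym subr_eq0 => /eqP ->.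
by rewrite dH_hV.
Qed.

End Augmented.

(** * Exactness *)

Lemma exact_atP (U V W : zmodType) (A : set U) (f : U -> V) (B : set V)
    (g : V -> W) :
  (forall y, A y -> B (f y) /\ g (f y) = 0) ->
  (forall x, B x -> g x = 0 -> exists2 y, A y & f y = x) ->
  exact_at A f B g.
Proof.
move=> fA gB; apply/seteqP; split=> [x [Bx gx]|_ [y Ay <-]]; last exact: fA.
by have [y Ay yE] := gB x Bx gx; exists y.
Qed.

Section Exactness.
Variable R : realType.

Lemma exact_dH_positive n p :
  exact_at (Omega R n.+2 p.+1) (@dH R n.+1 p.+1)
           (Omega R n.+1 p.+1) (@dH R n p.+1).
Proof.
apply: exact_atP => [y yO|x xO x0]; last exact: dH_exact_positive.
by split; [exact: Omega_dH|exact: dH_dH].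
Qed.

Lemma exact_dH_zero n :
  exact_at (Omega R n.+2 0) (@dH R n.+1 0) (Omega R n.+1 0) (@dH R n 0).
Proof.
apply: exact_atP => [y yO|x xO x0]; last exact: dH_exact_zero.
by split; [exact: Omega_dH|exact: dH_dH].
Qed.

Lemma exact_Iop p :
  exact_at (Omega R 1 p.+1) (@dH R 0 p.+1) (Omega R 0 p.+1) (@Iop R p).
Proof.
apply: exact_atP => [y yO|x xO x0].
  by split; [exact: Omega_dH|exact: Iop_dH].
exists (aug_hH x); first exact: Omega_aug_hH.
by rewrite [RHS](horizontal_homotopy xO) x0 add0r.
Qed.

Lemma exact_calI p :
  exact_at (Omega R 0 p.+1) (@Iop R p) (calI R p)
           (fun _ : lincomb R 0 p.+1 => 0 : R).
Proof.
by apply: exact_atP => [y yO|x [y yO <-] _]; [split=> //; exists y|exists y].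
Qed.

Lemma exact_dV_start n :
  exact_at [set 0] (fun x : lincomb R n 0 => x) (Omega R n 0) (@dV R n 0).
Proof.
apply: exact_atP => [y ->|x xO x0].
  split; last by rewrite -[in LHS](subrr 0) dV_sub subrr.
  apply/OmegaP; split=> [|s|s] /=; first exact: span0.
    by rewrite linear0 scaler0.
  by rewrite linear0 scaler0.
by exists x => //=; rewrite -(hV_dV xO) x0 hV0.
Qed.

Lemma exact_dV n p :
  exact_at (Omega R n p) (@dV R n p) (Omega R n p.+1) (@dV R n p.+1).
Proof.
apply: exact_atP => [y yO|x xO x0].
  by split; [exact: Omega_dV|exact: dV_dV].
exists (hV x); first exact: Omega_hV.
by rewrite -[RHS](vertical_homotopy xO) x0 hV0 add0r.
Qed.

Lemma exact_deltaV p :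
  exact_at (calI R p) (@deltaV R p.+1) (calI R p.+1) (@deltaV R p.+2).
Proof.
apply: exact_atP => [y /calI_P[yO _]|x xI x0].
  by split; [exact: calI_deltaV|exact: deltaV_deltaV].
exists (aug_hV x); first exact: calI_aug_hV.
by rewrite [RHS](augmented_homotopy xI) x0 aug_hV0 addr0.
Qed.

Lemma exact_Omega_zero :
  exact_at (Omega R 1 0) (@dH R 0 0) (Omega R 0 0) (@deltaV R 0).
Proof.
apply: exact_atP => [y yO|x xO x0]; last exact: deltaV_exact_zero.
split; first exact: Omega_dH.
by rewrite /deltaV -dH_dV // Iop_dH //; exact: Omega_dV.
Qed.

Lemma exact_calI_zero :
  exact_at (Omega R 0 0) (@deltaV R 0) (calI R 0) (@deltaV R 1).
Proof.
apply: exact_atP => [y yO|x xI x0].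
  by split; [exact: calI_deltaV|exact: deltaV_deltaV].
have [xO _] := (calI_P _).1 xI.
exists (hV x); first exact: Omega_hV.
by rewrite -[RHS](Iop_vertical xI) x0 aug_hV0 addr0.
Qed.

End Exactness.

Theorem theorem4p1 (R : realType) :
  (* domains and codomains of the operators *)
  [/\ (forall n p, @dH R n p @` Omega R n.+1 p `<=` Omega R n p)
      /\ (forall n p, @dV R n p @` Omega R n p `<=` Omega R n p.+1)
      /\ (forall n p, @hV R n p @` Omega R n p.+1 `<=` Omega R n p),
      (forall p, @Iop R p @` Omega R 0 p.+1 `<=` Omega R 0 p.+1)
      /\ (forall p, @aug_hH R p @` Omega R 0 p.+1 `<=` Omega R 1 p.+1),
      @deltaV R 0 @` Omega R 0 0 `<=` calI R 0,
      (forall p, @deltaV R p.+1 @` calI R p `<=` calI R p.+1)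
    & (forall p, @aug_hV R p @` calI R p.+1 `<=` calI R p)]
  /\
  (* I^2 = I, I d_H = 0, delta_V^2 = 0 *)
  [/\ forall p (x : lincomb R 0 p.+1), Omega R 0 p.+1 x -> Iop (Iop x) = Iop x,
      forall p (x : lincomb R 1 p.+1), Omega R 1 p.+1 x -> Iop (dH x) = 0,
      forall x : lincomb R 0 0, Omega R 0 0 x -> deltaV (deltaV x) = 0
    & forall p (x : lincomb R 0 p.+1), calI R p x -> deltaV (deltaV x) = 0]
  /\
  (* homotopy identities *)
  [/\ forall p (x : lincomb R 0 p.+1), Omega R 0 p.+1 x ->
        x = Iop x + dH (aug_hH x),
      forall x : lincomb R 0 1, calI R 0 x ->
        x = deltaV (hV x) + aug_hV (deltaV x)
    & forall p (x : lincomb R 0 p.+2), calI R p.+1 x ->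
        x = deltaV (aug_hV x) + aug_hV (deltaV x)]
  /\
  (* exactness of the rows: p >= 1, ending at I_p -> 0, and p = 0 *)
  [/\ forall n p,
        exact_at (Omega R n.+2 p.+1) (@dH R n.+1 p.+1)
                 (Omega R n.+1 p.+1) (@dH R n p.+1),
      forall p,
        exact_at (Omega R 1 p.+1) (@dH R 0 p.+1) (Omega R 0 p.+1) (@Iop R p),
      forall p,
        exact_at (Omega R 0 p.+1) (@Iop R p) (calI R p)
                 (fun _ : lincomb R 0 p.+1 => 0 : R)
    & forall n,
        exact_at (Omega R n.+2 0) (@dH R n.+1 0) (Omega R n.+1 0) (@dH R n 0)]
  /\
  (* exactness of the columns *)
  [/\ forall n,
        exact_at [set 0] (fun x : lincomb R n 0 => x) (Omega R n 0) (@dV R n 0),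
      forall n p,
        exact_at (Omega R n p) (@dV R n p) (Omega R n p.+1) (@dV R n p.+1)
    & forall p,
        exact_at (calI R p) (@deltaV R p.+1) (calI R p.+1) (@deltaV R p.+2)]
  /\
  (* exactness of the Euler-Lagrange complex *)
  [/\ forall n,
        exact_at (Omega R n.+2 0) (@dH R n.+1 0) (Omega R n.+1 0) (@dH R n 0),
      exact_at (Omega R 1 0) (@dH R 0 0) (Omega R 0 0) (@deltaV R 0),
      exact_at (Omega R 0 0) (@deltaV R 0) (calI R 0) (@deltaV R 1)
    & forall p,
        exact_at (calI R p) (@deltaV R p.+1) (calI R p.+1) (@deltaV R p.+2)].
Proof.
split; [split|split; [split|split; [split|split; [split|split; split]]]].
- split=> [n p _ [x xO <-]|]; first exact: Omega_dH.
  split=> [n p _ [x xO <-]|n p _ [x xO <-]]; first exact: Omega_dV.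
  exact: Omega_hV.
- split=> [p _ [x xO <-]|p _ [x xO <-]]; first exact: Omega_Iop.
  exact: Omega_aug_hH.
- by move=> _ [x xO <-]; apply: calI_deltaV.
- by move=> p _ [x /calI_P[xO _] <-]; apply: calI_deltaV.
- by move=> p _ [x xI <-]; apply: calI_aug_hV.
- exact: Iop_Iop.
- exact: Iop_dH.
- exact: deltaV_deltaV.
- by move=> p x /calI_P[xO _]; apply: deltaV_deltaV.
- exact: horizontal_homotopy.
- by move=> x xI; rewrite {1}(esym (Iop_vertical xI)).
- exact: augmented_homotopy.
- exact: exact_dH_positive.
- exact: exact_Iop.
- exact: exact_calI.
- exact: exact_dH_zero.
- exact: exact_dV_start.
- exact: exact_dV.
- exact: exact_deltaV.
- exact: exact_dH_zero.
- exact: exact_Omega_zero.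
- exact: exact_calI_zero.
- exact: exact_deltaV.
Qed.
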